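(* Let $0=s_0<s_1<\cdots<s_k<s_{k+1}=1$ be fixed, and let $\mathbf{F}(\mathbf{x},\tau)=\mathbf{f}_j(\mathbf{x},\tau)$ for $\tau\in(s_j,s_{j+1})$, $0\le j\le k$. Suppose that for $T=\bar{T}$, $\mathbf{x}=\bar{\mathbf{x}}$ is an absolutely continuous solution of $$\dot{\mathbf{x}}(\tau)=T\,\mathbf{F}(\mathbf{x}(\tau),\tau),\qquad \mathbf{x}(0)=\mathbf{x}_0,\qquad 0\le\tau\le1 .$$ Assume that for some $\rho>0$, each $\mathbf{f}_j(\boldsymbol{\chi},\tau)$, $0\le j\le k$, is continuous with respect to $\boldsymbol{\chi}$ and $\tau$ and Lipschitz continuous with respect to $\boldsymbol{\chi}$ on the tube $$\{(\boldsymbol{\chi},\tau):\tau\in[s_j,s_{j+1}]\text{ and }\boldsymbol{\chi}\in\mathcal{B}_\rho(\bar{\mathbf{x}}(\tau))\},\qquad 0\le j\le k.$$ Then $$\left.\frac{dC(T)}{dT}\right|_{T=\bar T}=\int_0^1 H(\bar{\mathbf{x}}(\tau),\mathbf{p}(\tau),\tau)\,d\tau,$$ where $H(\mathbf{x},\mathbf{p},\tau)=H_j(\mathbf{x},\mathbf{p},\tau)=\mathbf{p}\,\mathbf{f}_j(\mathbf{x},\tau)$ when $s_j\le\tau\le s_{j+1}$, and the row vector $\mathbf{p}:[0,1]\to\mathbb{R}^n$ is the solution of the linear differential equation $$\dot{\mathbf{p}}(\tau)=-\bar T\,\mathbf{p}(\tau)\nabla_x\mathbf{F}(\bar{\mathbf{x}}(\tau),\tau),\quad\tau\in[0,1],\qquad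 \mathbf{p}(1)=\nabla C(\bar{\mathbf{x}}(1)).$$
   Context: Setting. This is a free terminal time control problem rescaled to $[0,1]$ by $t=\tau T$: minimize $C(\mathbf{x}(1))$ subject to $\dot{\mathbf{x}}(\tau)=T\mathbf{f}(\mathbf{x}(\tau),\mathbf{u}(\tau))$, $\mathbf{x}(0)=\mathbf{x}_0$, where $C:\mathbb{R}^n\to\mathbb{R}$ and $\mathbf{f}:\mathbb{R}^n\times\mathbb{R}^m\to\mathbb{R}^n$ are differentiable. The control has feedback form $\mathbf{u}(\tau)=\boldsymbol{\phi}_j(\mathbf{x}(\tau),\tau)$ on $(s_j,s_{j+1})$, and $\mathbf{f}_j(\mathbf{x},\tau)=\mathbf{f}(\mathbf{x},\boldsymbol{\phi}_j(\mathbf{x},\tau))$. The switching points $s_j$ are held fixed while $T$ varies, and $C(T):=C(\mathbf{x}(1))$, where $\mathbf{x}$ is the solution of the initial value problem with parameter $T$. Differential equations are understood to hold at almost every $\tau$, with absolutely continuous solutions. Notation. $\|\cdot\|$ is any norm on $\mathbb{R}^n$, $\mathcal{B}_\rho(\mathbf{c})=\{\mathbf{x}:\|\mathbf{x}-\mathbf{c}\|\le\rho\}$. $\nabla C$ is a row vector and $\nabla_x\mathbf{F}$ is the Jacobian of $\mathbf{F}$ with respect to $\mathbf{x}$; the Jacobian $\nabla_x\mathbf{F}(\bar{\mathbf{x}}(\tau),\tau)$ appearing in the equation for $\mathbf{p}$ is presupposed to exist for every $\tau\in[0,1]$ other than the switching points.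
   Formalization: That the Jacobian of F exists at (x̄(τ),τ) is taken to mean that each f_j(·,τ) is (Fréchet) differentiable at x̄(τ) for τ in (s_j,s_{j+1}); with mere existence of the partial derivatives the formula can fail. *)

(* Defs.v *)
From HB Require Import structures.
From mathcomp Require Import all_boot all_order all_algebra.
From mathcomp Require Import all_classical all_reals all_analysis.
Import Order.TTheory GRing.Theory Num.Theory.
Import numFieldNormedType.Exports.

Set Implicit Arguments.
Unset Strict Implicit.
Unset Printing Implicit Defensive.

Local Open Scope classical_set_scope.
Local Open Scope ring_scope.

(* Vectors of R^n are row vectors 'rV[R]_n, with the product topology; the
   library Jacobian acts on rows, v *m 'J F x = 'd F x v, so the classical
   Jacobian matrix (dF_i / dx_j)_(i, j) is the transpose ('J F x)^T. *)

(* Nonnegativity and N 0 = 0 follow from these three axioms. *)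
Record is_norm (R : realType) (n : nat) (N : 'rV[R]_n -> R) : Prop := IsNorm {
  is_norm_triangle : forall x y, N (x + y) <= N x + N y ;
  is_norm_scale : forall a x, N (a *: x) = `|a| * N x ;
  is_norm_eq0 : forall x, N x = 0 -> x = 0 }.

Definition abs_continuous (R : realType) (V : normedModType R) (a b : R)
    (x : R -> V) : Prop :=
  forall eps : R, 0 < eps -> exists2 delta : R, 0 < delta &
    forall (q : nat) (u v : 'I_q -> R),
      (forall i, [/\ a <= u i, u i <= v i & v i <= b]) ->
      (forall i i', i != i' -> v i <= u i' \/ v i' <= u i) ->
      \sum_(i < q) (v i - u i) < delta ->
      \sum_(i < q) `|x (v i) - x (u i)| < eps.

(* Only the values of x on [0, 1] are relevant. *)
Definition ac_ode (R : realType) (V : normedModType R) (G : V -> R -> V)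
    (x : R -> V) : Prop :=
  abs_continuous 0 1 x /\
  {ae (@lebesgue_measure R), forall tau : R,
    tau \in `]0, 1[ -> is_derive tau 1 x (G (x tau) tau)}.

Definition unique_on01 (R : realType) (V : Type) (P : (R -> V) -> Prop) : Prop :=
  exists x, P x /\ forall y, P y -> {in `[0, 1], y =1 x}.

(* h j on the open interval ]s j, s j.+1[, and 0 at the points s 0, ..., s k.+1,
   which form a null set. *)
Definition piecewise (R : realType) (V : nmodType) (k : nat) (s : nat -> R)
    (h : nat -> V) (tau : R) : V :=
  \sum_(j < k.+1 | s j < tau < s j.+1) h j.

Section Control.
Variables (R : realType) (n m k : nat).
Variables (f : 'rV[R]_n * 'rV[R]_m -> 'rV[R]_n).
Variables (phi : nat -> 'rV[R]_n -> R -> 'rV[R]_m) (s : nat -> R).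

Definition fj (j : nat) (x : 'rV[R]_n) (tau : R) : 'rV[R]_n := f (x, phi j x tau).

Definition F (x : 'rV[R]_n) (tau : R) : 'rV[R]_n :=
  piecewise k s (fun j => fj j x tau) tau.

Definition H (x p : 'rV[R]_n) (tau : R) : R :=
  piecewise k s (fun j => (p *m (fj j x tau)^T) 0 0) tau.

Definition state_solution (x0 : 'rV[R]_n) (T : R) (x : R -> 'rV[R]_n) : Prop :=
  ac_ode (fun y tau => T *: F y tau) x /\ x 0 = x0.

Definition tube (N : 'rV[R]_n -> R) (xbar : R -> 'rV[R]_n) (rho : R) (j : nat) :
    set ('rV[R]_n * R) :=
  [set z | s j <= z.2 <= s j.+1 /\ N (z.1 - xbar z.2) <= rho].

Definition gradient (C : 'rV[R]_n -> R) (x : 'rV[R]_n) : 'rV[R]_n :=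
  \row_i 'D_(delta_mx 0 i) C x.

Definition costate_solution (C : 'rV[R]_n -> R) (Tbar : R)
    (xbar p : R -> 'rV[R]_n) : Prop :=
  ac_ode (fun q tau => - (Tbar *: (q *m ('J (F^~ tau) (xbar tau))^T))) p /\
  p 1 = gradient C (xbar 1).

End Control.

(* Main.v *)
Require Import Defs.
From HB Require Import structures.
From mathcomp Require Import all_boot all_order all_algebra.
From mathcomp Require Import all_classical all_reals all_analysis.
From mathcomp Require Import measurable_realfun.
From mathcomp Require Import ring lra.
Import Order.TTheory GRing.Theory Num.Theory.
Import numFieldNormedType.Exports.
Set Implicit Arguments.
Unset Strict Implicit.
Unset Printing Implicit Defensive.
Local Open Scope classical_set_scope.
Local Open Scope ring_scope.

(** Let x_T solve the state equation with parameter T and put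
    y = x_T - xbar.  The costate is the adjoint of the linearized state
    equation, so differentiating the scalar function p . y cancels the two
    terms in which the Jacobian J of F at xbar occurs:
      (p . y)' = (T - Tbar) p . F(xbar)
                 + (T - Tbar) p . (F(x_T) - F(xbar))
                 + Tbar p . (F(x_T) - F(xbar) - y J).
    Since y(0) = 0, integrating gives p(1) . y(1), which is the first-order
    variation of C(x_T(1)), on the left and (T - Tbar) times the integral of
    the Hamiltonian on the right, up to two error terms.  A Gronwall estimate
    gives y = O(|T - Tbar|) uniformly on [0, 1], so the first error is
    quadratic.  The second one, divided by |T - Tbar|, tends to 0 at every
    time because F is differentiable at xbar, and is bounded because F is
    Lipschitz; it vanishes in the limit by dominated convergence
    (mean_error_cvg0, dual_increment, terminal_cost_derivative).

    Nothing is assumed about how the Jacobian depends on time, so the costate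
    equation has coefficients that are merely bounded and measurable, and
    everything takes place among absolutely continuous functions.  The single
    tool that connects such functions with their derivatives is a mean value
    inequality, abs_continuous_mean_value: if |z'| <= w' almost everywhere,
    then |z(b) - z(a)| <= w(b) - w(a).  From it follow the Gronwall inequality
    abs_continuous_gronwall, hence uniqueness, and the contraction estimate
    behind the existence theorem caratheodory_picard.  Both equations are
    brought to the global setting of that theorem: the state equation by
    clipping the argument of F to a box around xbar, the costate equation by
    reversing time. *)

(** * Mean value inequality for absolutely continuous functions *)

(** Cousin's lemma as an induction principle, in place of tagged partitions: the
    supremum of the points that Q reaches from a is itself reached, and cannot
    be less than b. *)
Lemma interval_chaining (R : realType) (a b : R) (Q : R -> R -> Prop) :
  a <= b ->
  (forall u w v, a <= u -> u <= w -> w <= v -> v <= b ->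
     Q u w -> Q w v -> Q u v) ->
  (forall t, a <= t <= b -> exists2 d, 0 < d & forall u v,
     a <= u -> u <= t -> t <= v -> v <= b -> t - d < u -> v < t + d -> Q u v) ->
  Q a b.
Proof.
move=> ab Qcat Qloc.
have Qaa : Q a a.
  have [|d d0 Qd] := Qloc a; first by rewrite lexx.
  by apply: Qd; rewrite ?lexx ?ltrDl// ltrBlDr ltrDl.
pose S := [set t | a <= t <= b /\ Q a t].
have Sa : S a by split; rewrite ?lexx.
have supS : has_sup S.
  by split; [exists a | exists b => t [/andP[]]].
have ac : a <= sup S by exact: sup_upper_bound.
have cb : sup S <= b by apply: ge_sup => [|t [/andP[]]//]; exists a.
have [d d0 Qd] := Qloc (sup S) (introT andP (conj ac cb)).
have [t [/andP[at_ tb] Qat] ct] := sup_adherent d0 supS.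
have tc : t <= sup S by apply: sup_upper_bound => //; split => //; apply/andP.
set v := Num.min b (sup S + d / 2).
have cv : sup S <= v by rewrite le_min cb lerDl divr_ge0 ?ltW.
have vb : v <= b by rewrite ge_min lexx.
have vd : v < sup S + d.
  rewrite /v gt_min; apply/orP; right; lra.
have Qav : Q a v.
  apply: (Qcat a t v) => //; first exact: le_trans cv.
  exact: Qd.
have /(sup_upper_bound supS) : S v.
  by split => //; rewrite vb (le_trans ac cv).
rewrite /v ge_min => /orP[bc|]; last by rewrite leNgt => /negP []; lra.
by move: Qav; rewrite (_ : v = b)//; apply/le_anti; rewrite vb (le_trans bc cv).
Qed.

(** The increment over [u, v] is controlled by the derivative at any
    intermediate t: apply the definition on both sides of t and subtract. *)
Lemma is_derive_straddle (R : realType) (V : normedModType R) (z : R -> V)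
    (t : R) (l : V) (e : R) :
  is_derive t 1 z l -> 0 < e -> exists2 d, 0 < d & forall u v,
    u <= t -> t <= v -> t - d < u -> v < t + d ->
    `|z v - z u - (v - u) *: l| <= e * (v - u).
Proof.
move=> [dz zl] e0.
have : (fun h => h^-1 *: ((z \o shift t) (h *: 1) - z t)) @ 0^' --> l.
  by rewrite -zl.
move=> /cvgrPdist_le/(_ _ e0)[d /= d0 zd].
exists d => // u v ut tv du vd.
have key h : `|h| < d -> `|z (t + h) - z t - h *: l| <= e * `|h|.
  move=> hd; have [->|h0] := eqVneq h 0.
    by rewrite addr0 subrr scale0r subr0 !normr0 mulr0.
  have /= := zd h; rewrite sub0r normrN => /(_ hd h0).
  rewrite scaler1 (addrC h) => hle.
  rewrite (_ : _ - _ = - (h *: (l - h^-1 *: (z (t + h) - z t)))).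
    by rewrite normrN normrZ mulrC ler_wpM2r.
  by rewrite scalerBr scalerA divff// scale1r opprB.
have k1 : `|z v - z t - (v - t) *: l| <= e * (v - t).
  have := key (v - t); rewrite ger0_norm ?subr_ge0// (addrC t) subrK.
  by apply; lra.
have k2 : `|z u - z t - (u - t) *: l| <= e * (t - u).
  have := key (u - t); rewrite ler0_norm ?subr_le0// (addrC t) subrK opprB.
  by apply; lra.
have -> : z v - z u - (v - u) *: l =
    (z v - z t - (v - t) *: l) - (z u - z t - (u - t) *: l).
  have -> : v - u = (v - t) - (u - t) by ring.
  rewrite scalerBl (opprD (z u - z t)) [RHS]addrACA -opprD.
  by rewrite (opprB (z u)) (addrA (z v - z t)) subrK.
rewrite (le_trans (ler_normB _ _))// (_ : v - u = (v - t) + (t - u)); last by ring.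
by rewrite mulrDr lerD.
Qed.

Lemma ae_lebesgue_filter (R : realType) :
  Filter (almost_everywhere (@lebesgue_measure R)).
Proof. exact: ae_filter_ringOfSetsType. Qed.
#[local] Existing Instance ae_lebesgue_filter.

Lemma negligible_open_cover (R : realType) (E : set R) (d : R) :
  (@lebesgue_measure R).-negligible E -> 0 < d ->
  exists U : set R, [/\ open U, E `<=` U & (lebesgue_measure U < d%:E)%E].
Proof.
move=> [D [mD D0 ED]] d0.
have [|U [oU DU Ud]] := lebesgue_regularity_outer mD _ d0.
  by rewrite [ltLHS]D0 ltry.
exists U; split => //; first exact: subset_trans DU.
rewrite (le_lt_trans _ Ud)// -[X in lebesgue_measure X](setDUK DU).
rewrite measureU ?setDIK//; last by apply: measurableD => //; exact: open_measurable.
by rewrite [X in (X + _)%E]D0 add0e.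
Qed.

(** Lists rather than families indexed by ordinals, so that two families can be
    concatenated when intervals are chained. *)
Definition disjoint_intervals (R : realType) (u v : R) (l : seq (R * R)) :=
  all (fun p => [&& u <= p.1, p.1 <= p.2 & p.2 <= v]) l &&
  pairwise (fun p q => p.2 <= q.1) l.

Lemma disjoint_intervals_cat (R : realType) (u w v : R) (l1 l2 : seq (R * R)) :
  u <= w -> w <= v -> disjoint_intervals u w l1 -> disjoint_intervals w v l2 ->
  disjoint_intervals u v (l1 ++ l2).
Proof.
move=> uw wv /andP[/allP a1 p1] /andP[/allP a2 p2].
rewrite /disjoint_intervals all_cat pairwise_cat p1 p2 !andbT.
rewrite -andbA; apply/and3P; split.
- apply/allP => p /a1 /and3P[-> -> pw] /=; exact: le_trans wv.
- apply/allP => p /a2 /and3P[pw -> ->]; rewrite !andbT; exact: le_trans pw.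
- apply/allrelP => p q /a1/and3P[_ _ pw] /a2/and3P[wq _ _].
  exact: le_trans wq.
Qed.

Lemma abs_continuous_seq (R : realType) (V : normedModType R) (a b : R)
    (x : R -> V) (e : R) : abs_continuous a b x -> 0 < e ->
  exists2 d, 0 < d & forall l, disjoint_intervals a b l ->
    \sum_(p <- l) (p.2 - p.1) < d -> \sum_(p <- l) `|x p.2 - x p.1| < e.
Proof.
move=> /[apply] -[d d0 xd]; exists d => // l /andP[/allP al /(pairwiseP (0, 0)) pl].
rewrite !(big_nth (0, 0)) !big_mkord => ld.
apply: (xd _ (fun i => (nth (0, 0) l i).1) (fun i => (nth (0, 0) l i).2)) => //.
- by move=> i; have /al/and3P[] : nth (0, 0) l i \in l by rewrite mem_nth.
- move=> i i'; rewrite -val_eqE neq_ltn => /orP[] ii.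
  + by left; exact: (pl i i' (ltn_ord i) (ltn_ord i') ii).
  + by right; exact: (pl i' i (ltn_ord i') (ltn_ord i) ii).
Qed.

(** The points where the derivatives fail to exist, together with a and b, are
    covered by an open set U of small measure.  Around a good point the
    increments follow the derivatives up to a factor e; an interval around a
    bad point is recorded in a list of disjoint intervals inside U, on which
    absolute continuity makes the total increments of z and w smaller than e.
    Chaining these local estimates costs at most e (2 (b - a) + 2). *)
Theorem abs_continuous_mean_value (R : realType) (V : normedModType R)
    (a b : R) (z : R -> V) (w : R -> R) :
  a <= b -> abs_continuous a b z -> abs_continuous a b w ->
  {ae (@lebesgue_measure R), forall t, a < t < b -> exists l m,
     [/\ is_derive t 1 z l, is_derive t 1 w m & `|l| <= m]} ->
  `|z b - z a| <= w b - w a.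
Proof.
move=> ab zac wac zw.
rewrite -subr_ge0 -oppr_le0 opprB.
apply/ler_addgt0Pr => e0 e0_gt0; rewrite add0r.
pose e := e0 / (2 * (b - a) + 2).
have den : 0 < 2 * (b - a) + 2 by lra.
have e_gt0 : 0 < e by rewrite divr_gt0.
have [d1 d10 zd] := abs_continuous_seq zac e_gt0.
have [d2 d20 wd] := abs_continuous_seq wac e_gt0.
set P := (X in {ae _, forall t, X t}) in zw.
have badN : (@lebesgue_measure R).-negligible (~` P `|` ([set a] `|` [set b])).
  apply: negligibleU; first exact: zw.
  by apply: negligibleU; apply/negligibleP => //; exact: lebesgue_measure_set1.
have d0 : 0 < Num.min d1 d2 by rewrite lt_min d10.
have [U [oU badU Ud]] := negligible_open_cover badN d0.
(* The measure of U is localized to ]u, v], which makes the bound on the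
   total length of the recorded intervals additive under chaining. *)
pose Q u v := exists l, [/\ disjoint_intervals u v l,
  ((\sum_(p <- l) (p.2 - p.1))%:E <= lebesgue_measure (U `&` `]u, v]%classic))%E &
  `|z v - z u| - (w v - w u) <= 2 * e * (v - u) +
    (\sum_(p <- l) `|z p.2 - z p.1| + \sum_(p <- l) `|w p.2 - w p.1|)].
have [l [lab lU lzw]] : Q a b.
  apply: interval_chaining => //.
  - move=> u m v au um mv vb [l1 [i1 U1 l1zw]] [l2 [i2 U2 l2zw]].
    exists (l1 ++ l2); split; first exact: disjoint_intervals_cat i1 i2.
    + rewrite big_cat/= EFinD (_ : U `&` `]u, v] =
        (U `&` `]u, m]) `|` (U `&` `]m, v])); last first.
        rewrite -setIUr; congr (_ `&` _).
        by apply: itv_bndbnd_setU; rewrite bnd_simp.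
      rewrite measureU ?leeD//.
      * by apply: measurableI => //; exact: open_measurable.
      * by apply: measurableI => //; exact: open_measurable.
      * rewrite -subset0 => x [[_ /=]] /[swap] -[_ /=].
        by rewrite !in_itv/= => /andP[mx _] /andP[_ /(lt_le_trans mx)]; rewrite ltxx.
    + have := ler_distD (z m) (z v) (z u).
      by rewrite !big_cat/=; nra.
  - move=> t /andP[ta tb].
    have [tU|tU] := pselect (U t).
      have /nbhs_ballP[d /= d_gt0 dU] := open_nbhs_nbhs (conj oU tU).
      exists d => // u v au ut tv vb du vd.
      exists [:: (u, v)]; rewrite !big_seq1/=; split.
      * by rewrite /disjoint_intervals/= !lexx (le_trans ut tv).
      * rewrite (_ : U `&` _ = `]u, v]%classic).
          by rewrite lebesgue_measure_itv/= lte_fin; case: ltP => uv;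
            rewrite -?EFinB lee_fin; lra.
        apply: setIidr => x /=; rewrite in_itv/= => /andP[ux xv].
        by apply: dU; rewrite /ball/= ltr_distlC; lra.
      * have := ler_norm (- (w v - w u)); rewrite normrN.
        have : 0 <= 2 * e * (v - u).
          by rewrite mulr_ge0 ?subr_ge0 ?(le_trans ut)// mulr_ge0 ?ltW.
        lra.
    have [tab Pt] : a < t < b /\ P t.
      have tNbad : ~ (~` P `|` ([set a] `|` [set b])) t by move=> /badU.
      split; last by apply: contrapT => nP; apply: tNbad; left.
      rewrite !lt_neqAle ta tb !andbT; apply/andP; split; apply/eqP => tE.
        by apply: tNbad; right; left.
      by apply: tNbad; right; right.
    have [l [m [dz dw lm]]] := Pt tab.
    have [r1 r10 zr] := is_derive_straddle dz e_gt0.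
    have [r2 r20 wr] := is_derive_straddle dw e_gt0.
    exists (Num.min r1 r2); first by rewrite lt_min r10.
    move=> u v au ut tv vb; rewrite ltrBlDr -ltrBlDl lt_min => /andP[tu1 tu2].
    rewrite -ltrBlDl lt_min => /andP[vt1 vt2].
    exists [::]; rewrite !big_nil; split => //.
    have uv : 0 <= v - u by lra.
    have {}zr : `|z v - z u - (v - u) *: l| <= e * (v - u) by apply: zr; lra.
    have {wr}/ler_normlP[wr _] :
      `|w v - w u - (v - u) *: m| <= e * (v - u) by apply: wr; lra.
    have : `|z v - z u| <= e * (v - u) + (v - u) * `|l|.
      rewrite -[z v - z u](subrK ((v - u) *: l)) (le_trans (ler_normD _ _))//.
      by rewrite lerD// normrZ ger0_norm.
    have : (v - u) * `|l| <= (v - u) * m by rewrite ler_wpM2l.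
    by move: wr; rewrite /GRing.scale/=; lra.
have lUd : \sum_(p <- l) (p.2 - p.1) < Num.min d1 d2.
  rewrite -lte_fin; apply: le_lt_trans lU _; apply: le_lt_trans Ud.
  apply: le_measure; rewrite ?inE//.
  - by apply: measurableI => //; exact: open_measurable.
  - exact: open_measurable.
move: lUd; rewrite lt_min => /andP[ld1 ld2].
have := zd _ lab ld1; have := wd _ lab ld2.
have : e * (2 * (b - a) + 2) = e0 by rewrite /e mulfVK// gt_eqF.
by lra.
Qed.

(** * Operations on absolutely continuous functions *)

Section AbsContinuous.
Variables (R : realType) (a b : R).

Lemma abs_continuous_sub (V : normedModType R) (a' b' : R) (x : R -> V) :
  a <= a' -> b' <= b -> abs_continuous a b x -> abs_continuous a' b' x.
Proof.
move=> aa bb xac e /xac[d d0 xd]; exists d => // q u v uv.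
apply: xd => i; have [au -> vb] := uv i; split => //.
  exact: le_trans au.
exact: le_trans bb.
Qed.

(** Source of the closure properties below: absolute continuity passes to any
    function whose increments are controlled by those of two others. *)
Lemma abs_continuous_dominated (V1 V2 V : normedModType R)
    (x1 : R -> V1) (x2 : R -> V2) (y : R -> V) (M : R) :
  abs_continuous a b x1 -> abs_continuous a b x2 ->
  (forall u v, a <= u <= b -> a <= v <= b ->
     `|y v - y u| <= M * (`|x1 v - x1 u| + `|x2 v - x2 u|)) ->
  abs_continuous a b y.
Proof.
move=> ac1 ac2 yM e e0.
have M10 : 0 < `|M| + 1 by rewrite ltr_wpDl.
pose c := e / (2 * (`|M| + 1)).
have c0 : 0 < c by rewrite divr_gt0// mulr_gt0.
have [d1 d10 x1d] := ac1 _ c0; have [d2 d20 x2d] := ac2 _ c0.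
exists (Num.min d1 d2); first by rewrite lt_min d10.
move=> q u v uv uv0; rewrite lt_min => /andP[s1 s2].
have {}x1d := x1d q u v uv uv0 s1; have {}x2d := x2d q u v uv uv0 s2.
apply: (@le_lt_trans _ _ ((`|M| + 1) * (\sum_(i < q) `|x1 (v i) - x1 (u i)| +
   \sum_(i < q) `|x2 (v i) - x2 (u i)|))).
  rewrite -big_split/= mulr_sumr; apply: ler_sum => i _.
  have [au uvi vb] := uv i.
  apply: (le_trans (yM _ _ _ _)).
  - by rewrite au (le_trans uvi).
  - by rewrite vb (le_trans au).
  by rewrite ler_wpM2r// (le_trans (ler_norm M))// lerDl.
apply: (@lt_le_trans _ _ ((`|M| + 1) * (c + c))).
  by rewrite ltr_pM2l// ltrD.
rewrite -mulr2n -mulr_natl mulrA (mulrC _ 2) /c mulrCA divff ?mulr1//.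
Qed.

Lemma abs_continuous_id : abs_continuous a b (@id R).
Proof.
move=> e e0; exists e => // q u v uv _; apply: le_lt_trans.
by apply: ler_sum => i _; have [_ ? _] := uv i; rewrite ger0_norm ?subr_ge0.
Qed.

Lemma lipschitz_abs_continuous (V : normedModType R) (y : R -> V) (M : R) :
  (forall u v, a <= u -> u <= v -> v <= b -> `|y v - y u| <= M * (v - u)) ->
  abs_continuous a b y.
Proof.
move=> yM; apply: (@abs_continuous_dominated _ _ _ id id _ (`|M|)).
- exact: abs_continuous_id.
- exact: abs_continuous_id.
move=> u v /andP[au ub] /andP[av vb].
wlog uv : u v au ub av vb / u <= v.
  move=> h; have [|/ltW] := leP u v; first exact: h.
  by move=> vu; rewrite distrC (distrC v); apply: h.
rewrite (le_trans (yM _ _ au uv vb))//.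
have vu0 : 0 <= v - u by rewrite subr_ge0.
rewrite (ger0_norm vu0) (le_trans (ler_wpM2r vu0 (ler_norm M)))//.
by rewrite ler_wpM2l// lerDl.
Qed.

Lemma abs_continuousB (V : normedModType R) (x y : R -> V) :
  abs_continuous a b x -> abs_continuous a b y ->
  abs_continuous a b (fun t => x t - y t).
Proof.
move=> xac yac; apply: (abs_continuous_dominated (M := 1) xac yac) => u v _ _.
by rewrite mul1r opprD addrACA -opprD ler_normB.
Qed.

Hypothesis ab : a <= b.

(** Composing with this retraction of R onto [a, b] turns a function that is
    only known on [a, b] into one that is continuous on the whole line, which
    avoids subspace topologies. *)
Definition clamp (t : R) : R := Num.max a (Num.min b t).

Lemma clamp_in t : a <= clamp t <= b.
Proof. by rewrite /clamp le_max lexx ge_max ab ge_min lexx. Qed.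

Lemma clamp_id t : a <= t <= b -> clamp t = t.
Proof. by move=> /andP[at_ tb]; rewrite /clamp min_r// max_r. Qed.

Lemma clamp_dist t u : `|clamp t - clamp u| <= `|t - u|.
Proof.
wlog tu : t u / u <= t.
  move=> h; have [|/ltW] := leP u t; first exact: h.
  by move=> vu; rewrite distrC (distrC t); apply: h.
have : 0 <= clamp t - clamp u <= t - u.
  rewrite /clamp.
  by case: (leP b t) => ?; case: (leP b u) => ?;
    do ?[case: (leP a _) => ?]; apply/andP; split; lra.
move=> /andP[c0 ctu].
by rewrite (ger0_norm c0) ger0_norm ?subr_ge0.
Qed.

Lemma abs_continuous_clamp (V : normedModType R) (x : R -> V) :
  abs_continuous a b x -> continuous (x \o clamp).
Proof.
move=> xac t; apply/cvgrPdist_lt => e e0.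
have [d d0 xd] := abs_continuous_seq xac e0.
have key u v : a <= u <= b -> a <= v <= b -> `|u - v| < d -> `|x u - x v| < e.
  move=> /andP[au ub] /andP[av vb].
  wlog uv : u v au ub av vb / u <= v.
    move=> h; have [|/ltW] := leP u v; first exact: h.
    by move=> vu uvd; rewrite distrC; apply: h; rewrite // distrC.
  rewrite distrC ger0_norm ?subr_ge0// => vud.
  have := xd [:: (u, v)]; rewrite !big_seq1/= distrC; apply => //.
  by rewrite /disjoint_intervals/= au uv vb.
exists d => //= u tu; apply: key; rewrite ?clamp_in//.
exact: le_lt_trans (clamp_dist _ _) tu.
Qed.

Lemma continuous_clamp_bounded (V : normedModType R) (x : R -> V) :
  continuous (x \o clamp) ->
  exists2 B, 0 <= B & forall t, a <= t <= b -> `|x t| <= B.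
Proof.
move=> xc; have : compact ((x \o clamp) @` `[a, b]).
  apply: continuous_compact; last exact: segment_compact.
  exact: continuous_subspaceT.
move=> /compact_bounded[M [_ xM]].
exists (`|M| + 1) => [|t tab]; first by rewrite addr_ge0.
apply: (xM (`|M| + 1)); first by rewrite (le_lt_trans (ler_norm M))// ltrDl.
by exists t => /=; rewrite ?in_itv//= clamp_id.
Qed.

Lemma abs_continuous_bounded (V : normedModType R) (x : R -> V) :
  abs_continuous a b x ->
  exists2 B, 0 <= B & forall t, a <= t <= b -> `|x t| <= B.
Proof. by move=> /abs_continuous_clamp/continuous_clamp_bounded. Qed.

End AbsContinuous.

Lemma is_derive_exp_barrier (R : realType) (c K t : R) :
  is_derive t 1 (fun s => c * expR (K * s)) (c * (K * expR (K * t))).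
Proof.
have d1 : is_derive t 1 (fun s : R => K * s) K.
  by apply: is_derive_eq; rewrite /GRing.scale/= !mulr1.
have d2 : is_derive t 1 (fun s : R => expR (K * s)) (K * expR (K * t)).
  have := @is_derive1_comp R expR (fun s => K * s) t _ _ (is_derive_expR _) d1.
  by rewrite mulrC.
by apply: is_derive_eq; rewrite /GRing.scale.
Qed.

Lemma abs_continuous_exp_barrier (R : realType) (a b c K : R) :
  abs_continuous a b (fun s => c * expR (K * s)).
Proof.
have w'c : continuous (fun s => c * (K * expR (K * s))).
  move=> s; apply: cvgM; first exact: cvg_cst.
  apply: cvgM; first exact: cvg_cst.
  apply: continuous_comp; last exact: continuous_expR.
  by apply: cvgM; [exact: cvg_cst|exact: cvg_id].
have [|M M0 w'M] := @continuous_clamp_bounded R a b _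
  (fun s => c * (K * expR (K * s))).
  move=> s; apply: continuous_comp; last exact: w'c.
  apply/cvgrPdist_lt => e e0; exists e => //= u; apply: le_lt_trans.
  exact: clamp_dist.
apply: (@lipschitz_abs_continuous _ _ _ _ _ M) => u v au uv vb.
have [x||s suv ->] := @MVT_segment R (fun s => c * expR (K * s))
   (fun s => c * (K * expR (K * s))) u v uv.
- by move=> _; exact: is_derive_exp_barrier.
- apply: continuous_subspaceT => x.
  by apply: differentiable_continuous; apply/derivable1_diffP;
    have [] := is_derive_exp_barrier c K x.
rewrite normrM (ger0_norm (_ : 0 <= v - u)) ?subr_ge0// ler_wpM2r ?subr_ge0//.
move: suv; rewrite in_itv/= => /andP[us sv]; apply: w'M.
by rewrite (le_trans au us) (le_trans sv vb).
Qed.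

(** * Gronwall inequality *)

(** Mean value inequality against the primitive of the right-hand side; the
    constant that would make the primitive vanish at b is dropped. *)
Lemma exp_barrier_bound (R : realType) (V : normedModType R) (z : R -> V)
    (b c A K : R) : 0 <= A -> 0 < K ->
  abs_continuous b c z ->
  {ae (@lebesgue_measure R), forall t, b < t < c -> exists2 l,
     is_derive t 1 z l & `|l| <= A * expR (K * t)} ->
  forall t, b <= t <= c -> `|z t - z b| <= A / K * expR (K * t).
Proof.
move=> A0 K0 zac zA t /andP[t0 tc].
set w := fun s : R => A / K * expR (K * s).
have wE : w t - w b <= w t.
  by rewrite gerBl mulr_ge0 ?expR_ge0// divr_ge0// ltW.
apply: le_trans wE; apply: abs_continuous_mean_value => //.
- exact: abs_continuous_sub zac.
- exact: abs_continuous_exp_barrier.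
move: zA; apply: filterS => s zA /andP[s0 st].
have [|l dz lA] := zA; first by rewrite s0 (lt_le_trans st tc).
exists l, (A / K * (K * expR (K * s))); split => //.
- exact: is_derive_exp_barrier.
- by rewrite mulrA divfK// gt_eqF.
Qed.

(** Let S be the supremum of |z(t)| e^(-K t), where K = 2 L + 1.  The barrier
    estimate gives S <= |z(b)| + (L S + M) / K, and L / K <= 1/2 lets S be
    absorbed in the left-hand side. *)
Theorem abs_continuous_gronwall (R : realType) (V : normedModType R)
    (z : R -> V) (b c L M : R) : 0 <= b -> b <= c -> c <= 1 -> 0 <= L -> 0 <= M ->
  abs_continuous b c z ->
  {ae (@lebesgue_measure R), forall t, b < t < c -> exists2 l,
     is_derive t 1 z l & `|l| <= L * `|z t| + M} ->
  forall t, b <= t <= c -> `|z t| <= 2 * expR (2 * L + 1) * (`|z b| + M).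
Proof.
move=> b0 bc c1 L0 M0 zac zL.
set K := 2 * L + 1; have K1 : 1 <= K by rewrite /K; lra.
have K0 : 0 < K by lra.
pose S := [set `|z t| * expR (- (K * t)) | t in [set t | b <= t <= c]].
have [B B0 zB] := abs_continuous_bounded bc zac.
have S0 : S (`|z b| * expR (- (K * b))) by exists b; rewrite /= ?lexx.
have t_ge0 t : b <= t <= c -> 0 <= t by move=> /andP[/(le_trans b0)].
have supS : has_sup S.
  split; first by eexists; exact: S0.
  exists B => _ [t /= tc <-]; rewrite -[leRHS]mulr1 ler_pM// ?expR_ge0 ?zB//.
  by rewrite -expR0 ler_expR oppr_le0 mulr_ge0 ?(ltW K0)// t_ge0.
have sS t : b <= t <= c -> `|z t| <= sup S * expR (K * t).
  move=> tc; rewrite -ler_pdivrMr ?expR_gt0// -expRN.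
  by apply: sup_upper_bound => //; exists t.
have s0 : 0 <= sup S.
  apply: le_trans (sup_upper_bound supS S0).
  by rewrite mulr_ge0// expR_ge0.
have A0 : 0 <= L * sup S + M by rewrite addr_ge0// mulr_ge0.
have zt t : b <= t <= c ->
    `|z t| <= `|z b| + (L * sup S + M) / K * expR (K * t).
  move=> tc; rewrite -[z t](subrK (z b)) addrC (le_trans (ler_normD _ _))//.
  rewrite lerD2l; apply: (exp_barrier_bound A0 K0 zac) => //.
  move: zL; apply: filterS => s zL /andP[s_gt0 sc].
  have [|l dz lL] := zL; first by rewrite s_gt0.
  exists l => //; apply: (le_trans lL); rewrite mulrDl; apply: lerD.
    by rewrite -mulrA ler_wpM2l// sS// !ltW.
  by rewrite ler_peMr// -expR0 ler_expR mulr_ge0 ?(ltW K0)// (le_trans b0)// ltW.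
have supSle : sup S <= 2 * (`|z b| + M).
  have : sup S <= `|z b| + (L * sup S + M) / K.
    apply: ge_sup; first by eexists; exact: S0.
    move=> _ [t /= tc <-].
    rewrite expRN ler_pdivrMr ?expR_gt0// (le_trans (zt _ tc))//.
    rewrite [leRHS]mulrDl lerD2r.
    by rewrite ler_peMr// -expR0 ler_expR mulr_ge0 ?(ltW K0)// t_ge0.
  have : (L * sup S + M) / K <= sup S / 2 + M.
    by rewrite ler_pdivrMr// /K; nra.
  lra.
move=> t tc; rewrite (le_trans (sS _ tc))// mulrAC.
apply: ler_pM => //; rewrite ?expR_ge0//.
rewrite ler_expR ler_piMr ?(ltW K0)//; case/andP: tc => _ tc.
exact: le_trans c1.
Qed.

(** * Primitives of bounded measurable functions *)

Section Primitive.
Variable R : realType.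
Notation mu := (@lebesgue_measure R).

Lemma bounded_integrable_itv (f : R -> R) (M : R) (i j : bool) (u v : R) :
  measurable_fun setT f -> (forall t, `|f t| <= M) ->
  mu.-integrable [set` Interval (BSide i u) (BSide j v)] (EFin \o f).
Proof.
move=> mf fM; apply: measurable_bounded_integrable => //.
- rewrite [ltLHS]lebesgue_measure_itv/=; case: ifP => _ //.
  by rewrite -EFinB ltry.
- exact: measurable_funTS.
- exists M; split; rewrite ?num_real// => B MB t _.
  exact: le_trans (fM t) (ltW MB).
Qed.

Lemma Rintegral_diff_bound (f : R -> R) (M u v : R) :
  measurable_fun setT f -> (forall t, `|f t| <= M) -> 0 <= u -> u <= v ->
  `|\int[mu]_(s in `[0, v]) f s - \int[mu]_(s in `[0, u]) f s| <= M * (v - u).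
Proof.
move=> mf fM u0 uv.
rewrite Rintegral_itvB ?bnd_simp//; last exact: bounded_integrable_itv fM.
have ifuv : mu.-integrable `]u, v] (EFin \o f) by exact: bounded_integrable_itv fM.
rewrite (le_trans (le_normr_Rintegral _ _))//.
apply: (@le_trans _ _ (\int[mu]_(s in `]u, v]) M)).
  apply: le_Rintegral => //.
  - apply: (@bounded_integrable_itv _ M) => [|t]; last by rewrite normr_id.
    exact: measurableT_comp.
  - by apply: (@bounded_integrable_itv _ `|M|).
rewrite Rintegral_cst// [X in fine X]lebesgue_measure_itv/= lte_fin.
by case: ltP => vu; rewrite -?EFinB/= ?mulr0 ?mulr_ge0 ?subr_ge0//
  (le_trans _ (fM 0)).
Qed.

(** Lebesgue's differentiation theorem; boundedness gives local
    integrability. *)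
Lemma Rintegral_is_derive (f : R -> R) (M : R) :
  measurable_fun setT f -> (forall t, `|f t| <= M) ->
  {ae mu, forall t : R, 0 < t ->
    is_derive t 1 (fun x => \int[mu]_(s in `[0, x]) f s) (f t)}.
Proof.
move=> mf fM.
have lf : locally_integrable [set: R] f.
  split => //; first exact: openT.
  move=> K _ cK; rewrite (@le_lt_trans _ _ (\int[mu]_(x in K) `|M|%:E)%E)//.
    apply: ge0_le_integral => //.
    - exact: compact_measurable.
    - by apply/measurable_EFinP/measurable_funTS; exact: measurableT_comp.
    - by move=> x _; rewrite lee_fin (le_trans (fM x))// ler_norm.
  rewrite integral_cst//; last exact: compact_measurable.
  by rewrite lte_mul_pinfty// compact_finite_measure.
have := FTC1 (a := BLeft 0)
  (fun y => bounded_integrable_itv true false 0 y mf fM) lf.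
apply: filterS => t + t0.
move=> []; first by exact: t0.
by move=> dF; rewrite derive1E => Ft; split.
Qed.

Definition bounded_measurable n (g : R -> 'rV[R]_n) :=
  (forall i, measurable_fun setT (fun t => g t 0 i)) /\
  exists M, forall t, `|g t| <= M.

(** The upper limit is clamped so that a primitive is a bounded continuous
    function on the whole line, determined by its values on [0, 1]. *)
Definition primitive n (g : R -> 'rV[R]_n) (t : R) : 'rV[R]_n :=
  \row_i \int[mu]_(s in `[0, clamp 0 1 t]) g s 0 i.

Lemma normr_coord_le n (x : 'rV[R]_n) i : `|x 0 i| <= `|x|.
Proof.
rewrite [leRHS]/Num.Def.normr/= mx_normrE.
exact: (@le_bigmax _ _ _ 0 (fun ij => `|x ij.1 ij.2|) (0, i)).
Qed.

Lemma normr_le_coord n (x : 'rV[R]_n) (e : R) : 0 <= e ->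
  (forall i, `|x 0 i| <= e) -> `|x| <= e.
Proof.
move=> e0 xe; rewrite [leLHS]/Num.Def.normr/= mx_normrE.
by apply: bigmax_le => // -[i j] _ /=; rewrite ord1.
Qed.

Lemma is_derive_coord n (z : R -> 'rV[R]_n) (t : R) (l : 'rV[R]_n) i :
  is_derive t 1 z l -> is_derive t 1 (fun s => z s 0 i) (l 0 i).
Proof.
move=> [dz <-]; split; first exact: (derivable_mxP _ _ _).1 dz 0 i.
by rewrite derive_mx// mxE.
Qed.

Lemma is_derive_row n (z : R -> 'rV[R]_n) (t : R) (l : 'rV[R]_n) :
  (forall i, is_derive t 1 (fun s => z s 0 i) (l 0 i)) -> is_derive t 1 z l.
Proof.
move=> zl; have dz : derivable z t 1.
  by apply/derivable_mxP => i j; rewrite ord1; have [] := zl j.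
split => //; rewrite derive_mx//; apply/rowP => i; rewrite mxE.
by have [] := zl i.
Qed.

Lemma primitive_lipschitz n (g : R -> 'rV[R]_n) (M u v : R) :
  (forall i, measurable_fun setT (fun t => g t 0 i)) ->
  (forall t, `|g t| <= M) -> `|primitive g v - primitive g u| <= M * `|v - u|.
Proof.
move=> mg gM; have M0 : 0 <= M by rewrite (le_trans _ (gM 0)).
apply: (@le_trans _ _ (M * `|clamp 0 1 v - clamp 0 1 u|)); last first.
  by rewrite ler_wpM2l// clamp_dist.
apply: normr_le_coord => [|i]; first by rewrite mulr_ge0.
rewrite !mxE; have h (x : R) : 0 <= clamp 0 1 x.
  by case/andP: (@clamp_in R 0 1 ler01 x).
move: (h u) (h v); move: (clamp 0 1 u) (clamp 0 1 v) => u' v' u0 v0.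
wlog uv : u' v' u0 v0 / u' <= v'.
  move=> hw; have [|/ltW] := leP u' v'; first exact: hw.
  by move=> vu; rewrite distrC (distrC v'); apply: hw.
rewrite (ger0_norm (_ : 0 <= v' - u')) ?subr_ge0//.
apply: Rintegral_diff_bound => // t.
by rewrite (le_trans (normr_coord_le _ _)).
Qed.

Lemma primitive_continuous n (g : R -> 'rV[R]_n) :
  bounded_measurable g -> continuous (primitive g).
Proof.
move=> [mg [M gM]] t; apply/cvgrPdist_lt => e e0.
have M1 : 0 < `|M| + 1 by rewrite ltr_wpDl.
exists (e / (`|M| + 1)); first by rewrite /= divr_gt0.
move=> u /=; rewrite ltr_pdivlMr// => tu.
rewrite (le_lt_trans (primitive_lipschitz _ _ mg gM))//.
rewrite (le_lt_trans _ tu)// mulrC ler_wpM2l//.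
by rewrite (le_trans (ler_norm M))// lerDl.
Qed.

Lemma primitive_abs_continuous n (g : R -> 'rV[R]_n) (a b : R) :
  bounded_measurable g -> abs_continuous a b (primitive g).
Proof.
move=> [mg [M gM]]; apply: (@lipschitz_abs_continuous _ _ _ _ _ M).
move=> u v _ uv _; rewrite (le_trans (primitive_lipschitz _ _ mg gM))//.
by rewrite ger0_norm// subr_ge0.
Qed.

Lemma primitive0 n (g : R -> 'rV[R]_n) : primitive g 0 = 0.
Proof.
apply/rowP => i; rewrite !mxE clamp_id ?lexx ?ler01//.
by rewrite set_itv1 Rintegral_set1.
Qed.

Lemma primitive_clamp n (g : R -> 'rV[R]_n) t :
  primitive g (clamp 0 1 t) = primitive g t.
Proof. by rewrite /primitive (clamp_id (clamp_in ler01 t)). Qed.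

Lemma primitive_is_derive n (g : R -> 'rV[R]_n) :
  bounded_measurable g ->
  {ae mu, forall t : R, 0 < t < 1 -> is_derive t 1 (primitive g) (g t)}.
Proof.
move=> [mg [M gM]].
have : {ae mu, forall t : R, forall i, 0 < t ->
    is_derive t 1 (fun x => \int[mu]_(s in `[0, x]) g s 0 i) (g t 0 i)}.
  apply: filter_forall => i.
  apply: (@Rintegral_is_derive _ M) => // t.
  by rewrite (le_trans (normr_coord_le _ _)).
apply: filterS => t dg /andP[t0 t1]; apply: is_derive_row => i.
apply: near_eq_is_derive (dg i t0).
near=> s; rewrite mxE clamp_id//; apply/andP; split; apply: ltW; near: s.
- exact: lt_nbhsr.
- exact: lt_nbhsl.
Unshelve. all: by end_near. Qed.

End Primitive.

(** * Picard iteration for Caratheodory equations *)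

Lemma geometric_small (R : realType) (C e : R) : 0 < e ->
  \forall k \near \oo, C * 2^-1 ^+ k <= e.
Proof.
move=> e0; have M1 : 0 < `|C| + 1 by rewrite ltr_wpDl.
have h : `|(2 : R)^-1| < 1 by rewrite ger0_norm ?invr_ge0// invf_lt1// ltr1n.
have /cvgrPdist_le/(_ (e / (`|C| + 1))) := cvg_expr h.
rewrite divr_gt0// => /(_ isT); apply: filterS => k.
rewrite sub0r normrN ger0_norm ?exprn_ge0 ?invr_ge0// ler_pdivlMr// mulrC.
apply: le_trans; rewrite ler_wpM2r ?exprn_ge0 ?invr_ge0//.
by rewrite (le_trans (ler_norm C))// lerDl.
Qed.

Section Picard.
Variables (R : realType) (n : nat) (G : 'rV[R]_n -> R -> 'rV[R]_n).
Variables (L M : R) (x0 : 'rV[R]_n).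
Hypothesis L0 : 0 <= L.
Hypothesis GL : forall x y t, `|G x t - G y t| <= L * `|x - y|.
Hypothesis GM : forall t, `|G 0 t| <= M.
Hypothesis Gm : forall z : R -> 'rV[R]_n, continuous z ->
  forall i, measurable_fun setT (fun t : R => G (z t) t 0 i).

Let K := 2 * L + 1.
Let K0 : 0 < K. Proof. by rewrite /K ltr_wpDl// mulr_ge0. Qed.

Let admissible (z : R -> 'rV[R]_n) :=
  continuous z /\ exists B, forall t, `|z t| <= B.

Let Phi (z : R -> 'rV[R]_n) t := x0 + primitive (fun s => G (z s) s) t.

Let admissible_bounded_measurable z : admissible z ->
  bounded_measurable (fun s => G (z s) s).
Proof.
move=> [zc [B zB]]; split; first exact: Gm.
exists (L * B + M) => t; rewrite -[G _ _](subrK (G 0 t)).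
rewrite (le_trans (ler_normD _ _))// lerD// (le_trans (GL _ _ _))//.
by rewrite subr0 ler_wpM2l.
Qed.

Let admissible_Phi z : admissible z -> admissible (Phi z).
Proof.
move=> az; have bm := admissible_bounded_measurable az; split.
  move=> t; apply: cvgD; first exact: cvg_cst.
  exact: primitive_continuous.
have [mg [B gB]] := bm; exists (`|x0| + B) => t.
have B0 : 0 <= B by rewrite (le_trans _ (gB 0)).
rewrite (le_trans (ler_normD _ _))// lerD2l -primitive_clamp.
rewrite -[primitive _ _]subr0 -(primitive0 (fun s => G (z s) s)).
rewrite (le_trans (primitive_lipschitz _ _ mg gB))// subr0.
have /andP[c0 c1] := @clamp_in R 0 1 ler01 t.
by rewrite ger0_norm// ler_piMr.
Qed.

(** The weight e^(K t) makes the integral operator a contraction of ratio 1/2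
    on the whole of [0, 1], whatever the Lipschitz constant. *)
Let Phi_contraction z y D : admissible z -> admissible y -> 0 <= D ->
  (forall t, 0 <= t <= 1 -> `|z t - y t| <= D * expR (K * t)) ->
  forall t, 0 <= t <= 1 -> `|Phi z t - Phi y t| <= D / 2 * expR (K * t).
Proof.
move=> az ay D0 zyD t t01.
have bz := admissible_bounded_measurable az.
have by_ := admissible_bounded_measurable ay.
rewrite /Phi opprD addrACA subrr add0r.
pose w s := primitive (fun s => G (z s) s) s - primitive (fun s => G (y s) s) s.
have -> : primitive (fun s => G (z s) s) t - primitive (fun s => G (y s) s) t
    = w t - w 0 by rewrite /w !primitive0 subrr subr0.
apply: (@le_trans _ _ (L * D / K * expR (K * t))); last first.
  rewrite ler_wpM2r ?expR_ge0// ler_pdivrMr// /K.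
  by have := mulr_ge0 L0 D0; lra.
apply: (@exp_barrier_bound _ _ w 0 1) => //.
- by rewrite mulr_ge0.
- by apply: abs_continuousB; exact: primitive_abs_continuous.
move: (primitive_is_derive bz) (primitive_is_derive by_).
apply: filterS2 => s dz dy s01; exists (G (z s) s - G (y s) s).
  by apply: is_deriveB; [exact: dz|exact: dy].
rewrite (le_trans (GL _ _ _))// -mulrA ler_wpM2l// zyD//.
by case/andP: s01 => *; rewrite !ltW.
Qed.

Let X k := iter k Phi (cst x0).

Let admissible_X k : admissible (X k).
Proof.
elim: k => [|k]; last exact: admissible_Phi.
split; first by move=> t; exact: cvg_cst.
by exists `|x0|.
Qed.

Let X_clamp k t : X k (clamp 0 1 t) = X k t.
Proof. by case: k => //= k; rewrite /Phi primitive_clamp. Qed.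

Let X_step : exists2 D, 0 <= D &
  forall k t, `|X k.+1 t - X k t| <= D * 2^-1 ^+ k.
Proof.
have [_ [B0 X0B]] := admissible_X 0; have [_ [B1 X1B]] := admissible_X 1.
have D0 : 0 <= B1 + B0.
  by apply: addr_ge0; [exact: le_trans (normr_ge0 _) (X1B 0)|
    exact: le_trans (normr_ge0 _) (X0B 0)].
have step k : forall t, 0 <= t <= 1 ->
    `|X k.+1 t - X k t| <= (B1 + B0) * 2^-1 ^+ k * expR (K * t).
  elim: k => [t /andP[t0 t1]|k IH t t01].
    rewrite expr0 mulr1 (le_trans (ler_normB _ _))//.
    rewrite (le_trans (lerD (X1B t) (X0B t)))// ler_peMr//.
    by rewrite -expR0 ler_expR mulr_ge0// ltW.
  rewrite exprSr mulrA.
  apply: (Phi_contraction (admissible_X k.+1) (admissible_X k)) => //.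
  by rewrite mulr_ge0// exprn_ge0// invr_ge0.
exists ((B1 + B0) * expR K) => [|k t]; first by rewrite mulr_ge0// expR_ge0.
have ct := @clamp_in R 0 1 ler01 t.
rewrite -!(X_clamp _ t) (le_trans (step k _ ct))// mulrAC.
rewrite ler_wpM2r ?exprn_ge0 ?invr_ge0// ler_wpM2l// ler_expR.
by rewrite ler_piMr ?(ltW K0)//; case/andP: ct.
Qed.

Let X_limit : exists (x : R -> 'rV[R]_n) D, 0 <= D /\
  forall k t, `|x t - X k t| <= D * 2^-1 ^+ k.
Proof.
have [D D0 XD] := X_step.
have XX k m t : `|X (m + k)%N t - X k t| <= 2 * D * 2^-1 ^+ k.
  have : `|X (m + k)%N t - X k t| <= 2 * D * 2^-1 ^+ k * (1 - 2^-1 ^+ m).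
    elim: m => [|m IH]; first by rewrite subrr expr0 subrr mulr0 normr0.
    rewrite addSn (le_trans (ler_distD (X (m + k)%N t) _ _))//.
    rewrite (le_trans (lerD (XD _ t) IH))// exprD exprS.
    lra.
  move/le_trans; apply; rewrite ler_piMr ?gerBl ?exprn_ge0 ?invr_ge0//.
  by rewrite !mulr_ge0 ?exprn_ge0 ?invr_ge0.
have Xcvg t : cvg (X k t @[k --> \oo]).
  apply: cauchy_cvg; apply: cauchy_exP => e e0.
  have e20 : 0 < e / 2 by rewrite divr_gt0.
  have [N _ /(_ N (leqnn N))/= Ne] := geometric_small (2 * D) e20.
  exists (X N t); exists N => // k /= Nk.
  rewrite -ball_normE/= distrC -(subnK Nk) (le_lt_trans (XX _ _ _))//.
  by rewrite (le_lt_trans Ne)// ltr_pdivrMr// mulr_natr mulr2n ltrDl.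
exists (fun t => lim (X k t @[k --> \oo])), (2 * D).
split; first by rewrite mulr_ge0.
move=> k t; apply/ler_addgt0Pr => e e0.
have /cvgrPdist_le/(_ _ e0)[N _ Ne] := Xcvg t.
rewrite (le_trans (ler_distD (X (N + k)%N t) _ _))// addrC lerD// Ne//=.
by rewrite leq_addr.
Qed.

(** The iterates converge geometrically and uniformly, so their limit is
    continuous and a fixed point of the integral operator Phi.  The solution
    is taken to be Phi x, whose regularity is that of a primitive. *)
Theorem caratheodory_picard : exists x : R -> 'rV[R]_n, [/\ x 0 = x0,
  abs_continuous 0 1 x &
  {ae (@lebesgue_measure R), forall t : R, 0 < t < 1 ->
    is_derive t 1 x (G (x t) t)}].
Proof.
have [x [D [D0 xD]]] := X_limit.
have ax : admissible x.
  split.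
    move=> t; apply/cvgrPdist_lt => e e0.
    have e30 : 0 < e / 4 by rewrite divr_gt0.
    have [k _ /(_ k (leqnn k))/= ke] := geometric_small D e30.
    have [/(_ t)/cvgrPdist_lt/(_ _ e30) + _] := admissible_X k.
    apply: filterS => s ts.
    have := xD k s; have := xD k t.
    rewrite (distrC (x s)) => xt xs.
    rewrite (le_lt_trans (ler_distD (X k t) _ _))//.
    rewrite (le_lt_trans (lerD (lexx _) (ler_distD (X k s) _ _)))//.
    lra.
  have [_ [B X0B]] := admissible_X 0; exists (D + B) => t.
  rewrite -[x t](subrK (X 0%N t)) (le_trans (ler_normD _ _))// lerD//.
  by rewrite (le_trans (xD _ _))// expr0 mulr1.
have Phix t : 0 <= t <= 1 -> Phi x t = x t.
  move=> t01; apply/eqP; rewrite -subr_eq0 -normr_le0.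
  apply/ler_addgt0Pr => e e0; rewrite add0r.
  have [k _ /(_ k (leqnn k))/= ke] := geometric_small (D * expR K + D) e0.
  have p0 : 0 <= 2^-1 ^+ k :> R by rewrite exprn_ge0// invr_ge0.
  have : `|Phi x t - Phi (X k) t| <= D * 2^-1 ^+ k / 2 * expR (K * t).
    apply: (Phi_contraction ax (admissible_X k)) => //; first by rewrite mulr_ge0.
    move=> s /andP[s0 _]; rewrite (le_trans (xD _ _))// ler_peMr ?mulr_ge0//.
    by rewrite -expR0 ler_expR mulr_ge0// ltW.
  have := xD k.+1 t; rewrite exprS => x1 x2.
  rewrite (le_trans (ler_distD (X k.+1 t) _ _))//.
  rewrite (distrC _ (x t)) (le_trans (lerD x2 x1))//.
  rewrite (le_trans _ ke)// [leRHS]mulrDl; apply: lerD.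
    rewrite -!mulrA ler_wpM2l// (mulrC (expR K)) ler_wpM2l//.
    rewrite -[leRHS]mul1r ler_pM ?expR_ge0 ?invr_ge0//.
      by rewrite invf_le1// ler1n.
    by rewrite ler_expR ler_piMr ?(ltW K0)//; case/andP: t01.
  by rewrite ler_wpM2l// ler_piMl// invf_le1// ler1n.
have bm := admissible_bounded_measurable ax.
exists (Phi x); split.
- by rewrite /Phi primitive0 addr0.
- apply: (abs_continuous_dominated (M := 1) (primitive_abs_continuous 0 1 bm)
    (primitive_abs_continuous 0 1 bm)) => u v _ _.
  by rewrite /Phi opprD addrACA subrr add0r mul1r lerDl.
move: (primitive_is_derive bm); apply: filterS => t dt t01.
rewrite Phix; last by case/andP: t01 => *; rewrite !ltW.
have dG := dt t01; rewrite -[G _ _]add0r /Phi.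
by apply: is_deriveD.
Qed.

End Picard.

(** * Time reversal *)

Section Reflection.
Variable R : realType.
Notation mu := (@lebesgue_measure R).

Let reflect01 (t : R) : R := 1 - t.

Let measurable_reflect01 :
  measurable_fun setT (reflect01 : measurableTypeR R -> measurableTypeR R).
Proof. exact: measurable_funB. Qed.

(** Both sides are measures that agree on half-open intervals.  Needed so that
    properties holding almost everywhere survive time reversal, which turns
    the terminal condition of the costate into an initial one. *)
Lemma lebesgue_measure_reflect (A : set R) : measurable A ->
  pushforward mu (reflect01 : _ -> measurableTypeR R) A = mu A.
Proof.
move=> mA; apply/esym/lebesgue_measure_unique => //= _ [[a b]] _ <-.
rewrite /pushforward/= (_ : _ @^-1` _ = `[1 - b, 1 - a[%classic).
  rewrite !lebesgue_measure_itv/= !lte_fin.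
  rewrite (_ : (1 - b < 1 - a) = (a < b)); last by rewrite ltrD2l ltrN2.
  by case: ifP => // _; rewrite -!EFinB; congr EFin; ring.
apply/seteqP; split => x /=; rewrite !in_itv/= /reflect01 => /andP[? ?];
  apply/andP; split; lra.
Qed.

Lemma ae_reflect (P : R -> Prop) :
  {ae mu, forall t : R, P t} -> {ae mu, forall t : R, P (1 - t)}.
Proof.
move=> [N [mN N0 PN]]; exists (reflect01 @^-1` N); split.
- by rewrite -[X in measurable X]setTI; exact: measurable_reflect01.
- by rewrite -[RHS]N0 -(lebesgue_measure_reflect mN).
- by move=> t /= Pt; exact: PN.
Qed.

Lemma abs_continuous_reflect (V : normedModType R) (z : R -> V) :
  abs_continuous 0 1 z -> abs_continuous 0 1 (fun t => z (1 - t)).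
Proof.
move=> zac e /zac[d d0 zd]; exists d => // q u v uv uv0 s.
have -> : \sum_(i < q) `|z (1 - v i) - z (1 - u i)| =
    \sum_(i < q) `|z (1 - u i) - z (1 - v i)|.
  by apply: eq_bigr => i _; rewrite distrC.
apply: (zd q (fun i => 1 - v i) (fun i => 1 - u i)).
- by move=> i; have [u0 uvi v1] := uv i; split; lra.
- by move=> i i' /uv0[?|?]; [right|left]; lra.
- by rewrite (eq_bigr (fun i => v i - u i))// => i _; ring.
Qed.

Lemma is_derive_reflect n (z : R -> 'rV[R]_n) (t : R) l :
  is_derive (1 - t) 1 z l -> is_derive t 1 (fun s => z (1 - s)) (- l).
Proof.
move=> dz; apply: is_derive_row => i; rewrite mxE -mulrN1.
have dr : is_derive t 1 (fun s : R => 1 - s) (-1).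
  have := is_deriveB (is_derive_cst (1 : R) (t : R) 1) (is_derive_id (t : R) 1).
  by rewrite sub0r.
exact: (@is_derive1_comp R (fun s => z s 0 i) (fun s => 1 - s) t _ _
  (is_derive_coord i dz) dr).
Qed.

End Reflection.

(** * The state equation in a tube *)

Section Box.
Variables (R : realType) (n : nat) (r : R).
Hypothesis r0 : 0 <= r.

(** For the sup norm, clipping every coordinate is a 1-Lipschitz retraction
    onto the ball of radius r. *)
Definition box (v : 'rV[R]_n) : 'rV[R]_n := \row_i clamp (- r) r (v 0 i).

Lemma box_dist v w : `|box v - box w| <= `|v - w|.
Proof.
apply: normr_le_coord => // i; rewrite !mxE (le_trans (clamp_dist _ _ _ _))//.
by have := normr_coord_le (v - w) i; rewrite !mxE.
Qed.

Lemma box_id v : `|v| <= r -> box v = v.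
Proof.
move=> vr; apply/rowP => i; rewrite mxE clamp_id// -ler_norml.
exact: le_trans (normr_coord_le _ _) vr.
Qed.

Lemma box_le v : `|box v| <= r.
Proof.
apply: normr_le_coord => // i; rewrite mxE ler_norml.
by apply: clamp_in; rewrite (le_trans _ r0)// oppr_le0.
Qed.

Lemma box_le_norm v : `|box v| <= `|v|.
Proof.
have b0 : box 0 = 0 by apply: box_id; rewrite normr0.
by have := box_dist v 0; rewrite b0 !subr0.
Qed.

Lemma continuous_box (z : R -> 'rV[R]_n) :
  continuous z -> continuous (fun t => box (z t)).
Proof.
move=> zc t; apply/cvgrPdist_lt => e e0.
move/cvgrPdist_lt : (zc t) => /(_ _ e0); apply: filterS => s.
exact: le_lt_trans (box_dist _ _).
Qed.

End Box.

Section Tube.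
Variables (R : realType) (n : nat) (F : 'rV[R]_n -> R -> 'rV[R]_n).
Variables (xbar : R -> 'rV[R]_n) (r L M Tbar : R).
Notation mu := (@lebesgue_measure R).

(** What the argument uses of the vector field, for the sup norm and with
    constants that do not depend on time.  Measurability is asked along
    continuous curves only, since this is how F is evaluated. *)
Record tube_regular : Prop := TubeRegular {
  tube_radius : 0 < r ;
  tube_lip_ge0 : 0 <= L ;
  tube_out : forall x t, ~~ (0 < t < 1) -> F x t = 0 ;
  tube_lip : forall t x y, `|x| <= r -> `|y| <= r ->
    `|F (xbar t + x) t - F (xbar t + y) t| <= L * `|x - y| ;
  tube_bound : forall t, `|F (xbar t) t| <= M ;
  tube_measurable : forall z : R -> 'rV[R]_n, continuous z ->
    (forall t, `|z t| <= r) ->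
    forall i, measurable_fun setT (fun t : R => F (xbar t + z t) t 0 i) }.

Definition scaled_solution (T : R) (x : R -> 'rV[R]_n) : Prop :=
  abs_continuous 0 1 x /\
  {ae mu, forall t : R, 0 < t < 1 -> is_derive t 1 x (T *: F (x t) t)}.

Hypothesis HF : tube_regular.
Hypothesis xbarP : scaled_solution Tbar xbar.

Let r0 : 0 <= r. Proof. exact/ltW/(tube_radius HF). Qed.
Let L0 := tube_lip_ge0 HF.
Let M0 : 0 <= M. Proof. exact: le_trans (normr_ge0 _) (tube_bound HF 0). Qed.

(** A globally Lipschitz field that coincides with T F in the tube. *)
Definition boxed_field T x t := T *: F (xbar t + box r (x - xbar t)) t.

Let boxed_field_lip T x y t :
  `|boxed_field T x t - boxed_field T y t| <= `|T| * L * `|x - y|.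
Proof.
rewrite /boxed_field -scalerBr normrZ -mulrA ler_wpM2l//.
rewrite (le_trans (tube_lip HF _ _ _)) ?box_le//.
by rewrite ler_wpM2l// (le_trans (box_dist _ _ _))// opprB addrA subrK.
Qed.

Lemma tube_field_bound t x : `|x| <= r -> `|F (xbar t + x) t| <= L * r + M.
Proof.
move=> xr; have x0 : `|0 : 'rV[R]_n| <= r by rewrite normr0.
have := tube_lip HF t xr x0; rewrite addr0 subr0 => FL.
rewrite -[F _ _](subrK (F (xbar t) t)) (le_trans (ler_normD _ _))// lerD//.
  by rewrite (le_trans FL)// ler_wpM2l.
exact: tube_bound.
Qed.

Let xbar_clamp_continuous : continuous (xbar \o clamp 0 1).
Proof. by apply: abs_continuous_clamp; [exact: ler01|case: xbarP]. Qed.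

Let boxed_field_measurable T (z : R -> 'rV[R]_n) : continuous z -> forall i,
  measurable_fun setT (fun t : R => boxed_field T (z t) t 0 i).
Proof.
move=> zc i.
pose w t := box r (z t - xbar (clamp 0 1 t)).
have wc : continuous w.
  apply: continuous_box => t.
  by apply: cvgB; [exact: zc|exact: xbar_clamp_continuous].
rewrite (_ : (fun t => _) = (fun t => T * F (xbar t + w t) t 0 i)).
  apply: measurable_funM; first exact: measurable_cst.
  by apply: (tube_measurable HF) => // t; exact: box_le.
apply/funext => t; rewrite /boxed_field mxE /w.
have [t01|t01] := boolP (0 < t < 1); last by rewrite !(tube_out HF).
by rewrite clamp_id//; case/andP: t01 => *; rewrite !ltW.
Qed.

Lemma boxed_solution T : exists x : R -> 'rV[R]_n, [/\ x 0 = xbar 0,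
  abs_continuous 0 1 x &
  {ae mu, forall t : R, 0 < t < 1 -> is_derive t 1 x (boxed_field T (x t) t)}].
Proof.
apply: (@caratheodory_picard _ _ _ (`|T| * L) (`|T| * (L * r + M))).
- by rewrite mulr_ge0.
- exact: boxed_field_lip.
- by move=> t; rewrite normrZ ler_wpM2l// tube_field_bound// box_le.
- exact: boxed_field_measurable.
Qed.

(** Solve the clipped equation.  By Gronwall the solution stays within
    kappa |T - Tbar| of xbar, hence for T close to Tbar inside the tube, where
    clipping has no effect. *)
Theorem perturbed_solution : exists kappa delta : R, [/\ 0 <= kappa, 0 < delta &
  forall T, `|T - Tbar| < delta -> exists x : R -> 'rV[R]_n,
    [/\ x 0 = xbar 0, scaled_solution T x,
     kappa * `|T - Tbar| < r &
     forall t, 0 <= t <= 1 -> `|x t - xbar t| <= kappa * `|T - Tbar|]].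
Proof.
pose kappa := 2 * expR (2 * ((`|Tbar| + 1) * L) + 1) * M.
have k0 : 0 <= kappa by rewrite !mulr_ge0// expR_ge0.
have k1 : 0 < kappa + 1 by rewrite ltr_wpDl.
exists kappa, (Num.min 1 (r / (kappa + 1))); split => //.
  by rewrite lt_min ltr01 divr_gt0// (tube_radius HF).
move=> T; rewrite lt_min ltr_pdivlMr// => /andP[T1 Tr].
have kTr : kappa * `|T - Tbar| < r.
  by rewrite (le_lt_trans _ Tr)// mulrDr mulr1 mulrC lerDl.
have [x [x0 xac xode]] := boxed_solution T.
have xbound t : 0 <= t <= 1 -> `|x t - xbar t| <= kappa * `|T - Tbar|.
  move=> t01.
  have TL : `|T| * L <= (`|Tbar| + 1) * L.
    rewrite ler_wpM2r// -[T](subrK Tbar) addrC (le_trans (ler_normD _ _))//.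
    by rewrite lerD2l ltW.
  have := @abs_continuous_gronwall _ _ (fun s => x s - xbar s) 0 1
    ((`|Tbar| + 1) * L) (`|T - Tbar| * M).
  rewrite x0 subrr normr0 add0r => gw.
  rewrite /kappa -mulrA (mulrC M); apply: gw => //.
  - by rewrite mulr_ge0// addr_ge0.
  - by rewrite mulr_ge0.
  - by apply: abs_continuousB => //; case: xbarP.
  have [_] := xbarP; apply: filterS2 xode => s dx dxb s01.
  exists (boxed_field T (x s) s - Tbar *: F (xbar s) s).
    by apply: is_deriveB; [exact: dx|exact: dxb].
  rewrite /boxed_field.
  set a := F _ s; set b := F _ s.
  have -> : T *: a - Tbar *: b = T *: (a - b) + (T - Tbar) *: b.
    by rewrite scalerBr scalerBl addrA subrK.
  rewrite (le_trans (ler_normD _ _))// !normrZ lerD//; last first.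
    by rewrite ler_wpM2l// (tube_bound HF).
  apply: le_trans (ler_wpM2r (normr_ge0 _) TL); rewrite -mulrA ler_wpM2l//.
  have := @tube_lip HF s (box r (x s - xbar s)) 0.
  rewrite box_le// normr0 addr0 subr0 => /(_ isT r0)/le_trans; apply.
  by rewrite ler_wpM2l// box_le_norm.
exists x; split => //; split => //.
move: xode; apply: filterS => t xode t01.
rewrite (_ : T *: _ = boxed_field T (x t) t); first exact: xode.
rewrite /boxed_field box_id; first by rewrite addrC subrK.
apply: le_trans (xbound _ _) (ltW kTr).
by case/andP: t01 => *; rewrite !ltW.
Qed.

(** The competing solution y may leave the tube a priori.  Chain the relation
    (if y = x at u then y = x on [u, v]): near a time where y and x differ
    the premise fails, and near a time where they agree y is still inside the
    tube, since x stays at distance at most r' < r from xbar, so that Gronwall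
    applies. *)
Theorem tube_uniqueness T (x y : R -> 'rV[R]_n) (r' : R) :
  scaled_solution T x -> scaled_solution T y -> x 0 = y 0 -> r' < r ->
  (forall t, 0 <= t <= 1 -> `|x t - xbar t| <= r') ->
  forall t, 0 <= t <= 1 -> y t = x t.
Proof.
move=> [xac xode] [yac yode] xy0 r'r xr'.
pose Q u v := y u = x u -> forall s, u <= s <= v -> y s = x s.
suff Q01 : Q 0 1 by exact: Q01.
have [xbac _] := xbarP.
have yxc := abs_continuous_clamp ler01 (abs_continuousB yac xac).
have ybc := abs_continuous_clamp ler01 (abs_continuousB yac xbac).
apply: interval_chaining => //.
  move=> u w v _ uw wv _ Quw Qwv yxu s /andP[us sv].
  have [sw|ws] := leP s w; first by apply: Quw => //; rewrite us.
  by apply: Qwv; [apply: Quw; rewrite ?uw ?lexx|rewrite (ltW ws)].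
move=> t t01; have [yxt|/eqP yxt] := pselect (y t = x t); last first.
  have yx0 : 0 < `|y t - x t| by rewrite normr_gt0 subr_eq0.
  have /cvgrPdist_lt/(_ _ yx0)[d /= d0 yxd] := yxc t.
  exists d => // u v u0 ut tv v1 du dv yxu.
  have tu : `|t - u| < d by rewrite ger0_norm ?subr_ge0// ltrBlDr addrC -ltrBlDr.
  have u01 : 0 <= u <= 1.
    by rewrite u0 (le_trans ut)//; case/andP: t01.
  by have := yxd u tu; rewrite /= !clamp_id// yxu subrr subr0 ltxx.
have yr : 0 < r - `|y t - xbar t| by rewrite subr_gt0 yxt (le_lt_trans (xr' _ t01)).
have /cvgrPdist_lt/(_ _ yr)[d /= d0 yd] := ybc t.
exists d => // u v u0 ut tv v1 du dv yxu s suv.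
apply/eqP; rewrite -subr_eq0 -normr_le0.
have := @abs_continuous_gronwall _ _ (fun s => y s - x s) u v (`|T| * L) 0 u0
  (le_trans ut tv) v1.
rewrite yxu subrr normr0 addr0 mulr0; apply => //; first by rewrite mulr_ge0.
  by apply: abs_continuousB; [exact: abs_continuous_sub yac|
    exact: abs_continuous_sub xac].
apply: filterS2 xode yode => q xode yode /andP[uq qv].
have q01 : 0 < q < 1 by rewrite (le_lt_trans u0 uq) (lt_le_trans qv v1).
have q01' : 0 <= q <= 1 by case/andP: q01 => *; rewrite !ltW.
exists (T *: F (y q) q - T *: F (x q) q).
  by apply: is_deriveB; [exact: yode|exact: xode].
rewrite addr0 -scalerBr normrZ -mulrA ler_wpM2l//.
have yq : `|y q - xbar q| <= r.
  have tq : `|t - q| < d by rewrite ltr_distlC; apply/andP; split; lra.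
  have := yd q tq; rewrite /= !clamp_id// => /ltW h.
  rewrite -[y q - xbar q](subKr (y t - xbar t)) (le_trans (ler_normB _ _))//.
  by rewrite addrC -lerBrDr.
have xq : `|x q - xbar q| <= r by rewrite (le_trans (xr' _ q01'))// ltW.
have := tube_lip HF q yq xq.
by rewrite !(addrC (xbar q)) !subrK opprB addrA subrK.
Qed.

End Tube.

(** * The costate equation *)

Lemma continuous_coord_row (R : realType) n (z : R -> 'rV[R]_n) i :
  continuous z -> continuous (fun t => z t 0 i).
Proof.
move=> zc t; apply: (@continuous_comp _ _ _ z (fun v : 'rV[R]_n => v 0 i)).
  exact: zc.
exact: coord_continuous.
Qed.

Lemma normr_mulmx_le (R : realType) n (q : 'rV[R]_n) (A : 'M[R]_n) (c : R) :
  0 <= c -> (forall i j, `|A i j| <= c) -> `|q *m A| <= n%:R * c * `|q|.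
Proof.
move=> c0 Ac; apply: normr_le_coord => [|j]; first by rewrite !mulr_ge0.
rewrite mxE (le_trans (ler_norm_sum _ _ _))//.
apply: (@le_trans _ _ (\sum_(i < n) c * `|q|)).
  apply: ler_sum => i _; rewrite normrM mulrC ler_pM// ?Ac//.
  exact: normr_coord_le.
by rewrite sumr_const card_ord -[leLHS]mulr_natl mulrA.
Qed.

Section Costate.
Variables (R : realType) (n : nat) (F : 'rV[R]_n -> R -> 'rV[R]_n).
Variables (xbar : R -> 'rV[R]_n) (r L M Tbar : R).
Notation mu := (@lebesgue_measure R).
Hypothesis HF : tube_regular F xbar r L M.
Hypothesis FD : forall t, differentiable (F^~ t) (xbar t).

Definition state_jacobian (t : R) : 'M[R]_n := 'J (F^~ t) (xbar t).

Let J := state_jacobian.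
Let L0 := tube_lip_ge0 HF.

(* The increments step v k *: v tend to 0 and have norm at most r. *)
Let step (v : 'rV[R]_n) (k : nat) : R := r / ((`|v| + 1) * k.+1%:R).

Let step_gt0 v k : 0 < step v k.
Proof.
by rewrite divr_gt0 ?(tube_radius HF)// mulr_gt0// ltr_wpDl.
Qed.

Let step_le v k : `|step v k *: v| <= r.
Proof.
have v1 : 0 < `|v| + 1 by rewrite ltr_wpDl.
rewrite normrZ gtr0_norm// /step mulrAC ler_pdivrMr ?mulr_gt0//.
apply: ler_wpM2l; first exact/ltW/(tube_radius HF).
apply: (@le_trans _ _ (`|v| + 1)); first by rewrite lerDl.
by rewrite ler_peMr ?(ltW v1)// ler1n.
Qed.

Let step_cvg v : step v k @[k --> \oo] --> 0^'.
Proof.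
move=> P [d /= d0 dP].
have v1 : 0 < `|v| + 1 by rewrite ltr_wpDl.
have c0 : 0 < d * ((`|v| + 1) / r).
  by rewrite mulr_gt0// divr_gt0// (tube_radius HF).
have := near_infty_natSinv_lt (PosNum c0); apply: filterS => k /= kd.
apply: dP; last by rewrite gt_eqF.
rewrite /= sub0r normrN gtr0_norm// /step invfM mulrA.
rewrite -ltr_pdivlMl ?divr_gt0 ?(tube_radius HF)//.
by rewrite invf_div mulrC.
Qed.

(** The Jacobian as a sequential limit of difference quotients whose increments
    stay in the tube: this gives both its bound and its measurability. *)
Lemma jacobian_quotient_cvg v t :
  (step v k)^-1 *: (F (xbar t + step v k *: v) t - F (xbar t) t)
    @[k --> \oo] --> v *m J t.
Proof.
rewrite -(@deriveEjacobian _ _ _ _ _ v (FD t)).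
have /derivableP[dF _] := diff_derivable (v := v) (FD t).
have := cvg_comp _ _ (step_cvg v) dF; apply: cvg_trans; apply: near_eq_cvg.
by apply: nearW => k /=; rewrite (addrC (xbar t)).
Qed.

Lemma jacobian_bound (v : 'rV[R]_n) t : `|v *m J t| <= L * `|v|.
Proof.
apply/ler_addgt0Pr => e e0.
have /cvgrPdist_le/(_ _ e0)[k _ /(_ k (leqnn k))/= ke] := @jacobian_quotient_cvg v t.
rewrite -[v *m _](subrK
  ((step v k)^-1 *: (F (xbar t + step v k *: v) t - F (xbar t) t))).
rewrite addrC (le_trans (ler_normD _ _))// lerD//.
rewrite normrZ gtr0_norm ?invr_gt0// mulrC ler_pdivrMr//.
have r0 : `|0 : 'rV[R]_n| <= r by rewrite normr0 ltW// (tube_radius HF).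
have := tube_lip HF t (step_le v k) r0; rewrite addr0 subr0 normrZ.
by rewrite (gtr0_norm (step_gt0 v k)) (mulrC (step v k)) mulrA.
Qed.

Lemma jacobian_entry_bound t i j : `|J t i j| <= L.
Proof.
have -> : J t i j = ((delta_mx 0 i : 'rV[R]_n) *m J t) 0 j by rewrite -rowE [RHS]mxE.
rewrite (le_trans (normr_coord_le _ _))// (le_trans (jacobian_bound _ _))//.
rewrite ler_piMr//; apply: normr_le_coord => // l; rewrite mxE.
by case: (_ && _); rewrite ?normr1 ?normr0.
Qed.

Lemma jacobian_measurable i j : measurable_fun setT (fun t : R => J t i j).
Proof.
pose v : 'rV[R]_n := delta_mx 0 i.
have mF (w : 'rV[R]_n) : `|w| <= r ->
    measurable_fun setT (fun t : R => F (xbar t + w) t 0 j).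
  by move=> wr; apply: (tube_measurable HF (z := cst w)) => // t; exact: cvg_cst.
apply: (@measurable_fun_cvg _ _ _ _ (fun k t =>
  (step v k)^-1 * (F (xbar t + step v k *: v) t 0 j - F (xbar t + 0) t 0 j))).
  move=> k; apply: measurable_funM; first exact: measurable_cst.
  apply: measurable_funB; first exact: mF.
  by apply: mF; rewrite normr0 ltW// (tube_radius HF).
move=> t _.
have -> : J t i j = (v *m J t) 0 j by rewrite -rowE [RHS]mxE.
have := cvg_comp _ _ (@jacobian_quotient_cvg v t)
  (@coord_continuous R 1 n 0 j (v *m J t)).
apply: cvg_trans; apply: near_eq_cvg; apply: nearW => k /=.
by rewrite !mxE addr0.
Qed.

Lemma costate_bound (q : 'rV[R]_n) t :
  `|Tbar *: (q *m (J t)^T)| <= `|Tbar| * (n%:R * L) * `|q|.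
Proof.
rewrite normrZ -mulrA ler_wpM2l// normr_mulmx_le// => i j.
by rewrite mxE jacobian_entry_bound.
Qed.

Definition costate_ode (p : R -> 'rV[R]_n) : Prop :=
  abs_continuous 0 1 p /\ {ae mu, forall t : R, 0 < t < 1 ->
    is_derive t 1 p (- (Tbar *: (p t *m (J t)^T)))}.

(** In reversed time the equation has an initial condition and a field that is
    linear in the unknown, with bounded measurable coefficients. *)
Theorem costate_exists (g : 'rV[R]_n) :
  exists p : R -> 'rV[R]_n, costate_ode p /\ p 1 = g.
Proof.
pose G (x : 'rV[R]_n) (t : R) := Tbar *: (x *m (J (1 - t))^T).
have [||||q [q0 qac qode]] := @caratheodory_picard _ _ G (`|Tbar| * (n%:R * L)) 0 g.
- by rewrite !mulr_ge0.
- by move=> x y t; rewrite /G -scalerBr -mulmxBl costate_bound.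
- by move=> t; rewrite /G mul0mx scaler0 normr0.
- move=> z zc i.
  have -> : (fun t => G (z t) t 0 i) =
      (fun t => Tbar * \sum_(j < n) (z t 0 j * J (1 - t) i j)).
    apply/funext => t; rewrite /G !mxE; congr (_ * _).
    by apply: eq_bigr => j _; rewrite mxE.
  apply: measurable_funM; first exact: measurable_cst.
  apply: measurable_sum => j; apply: measurable_funM.
    by apply: continuous_measurable_fun; exact: continuous_coord_row.
  apply: (measurableT_comp (jacobian_measurable i j)).
  exact: measurable_funB.
exists (fun t => q (1 - t)); split; last by rewrite subrr.
split; first exact: abs_continuous_reflect.
move/ae_reflect: qode; apply: filterS => t qode /andP[t0 t1].
have := qode _; rewrite subr_gt0 t1 ltrBlDr ltrDl t0 => /(_ isT).
by move=> /is_derive_reflect; rewrite /G subKr.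
Qed.

Theorem costate_unique (p q : R -> 'rV[R]_n) : costate_ode p -> costate_ode q ->
  p 1 = q 1 -> forall t, 0 <= t <= 1 -> q t = p t.
Proof.
move=> [pac pode] [qac qode] pq1 t t01.
apply/eqP; rewrite -subr_eq0 -normr_le0 -(subKr 1 t).
have := @abs_continuous_gronwall _ _ (fun s => q (1 - s) - p (1 - s)) 0 1
  (`|Tbar| * (n%:R * L)) 0.
rewrite subr0 pq1 subrr normr0 addr0 mulr0; apply => //.
- by rewrite !mulr_ge0.
- by apply: abs_continuousB; exact: abs_continuous_reflect.
- move/ae_reflect: pode; move/ae_reflect: qode.
  apply: filterS2 => s qode pode /andP[s0 s1].
  have s01 : 0 < 1 - s < 1 by rewrite subr_gt0 s1 ltrBlDr ltrDl.
  exists (- - (Tbar *: (q (1 - s) *m (J (1 - s))^T)) -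
          - - (Tbar *: (p (1 - s) *m (J (1 - s))^T))).
    apply: is_deriveB.
      exact: is_derive_reflect (qode s01).
    exact: is_derive_reflect (pode s01).
  by rewrite !opprK addr0 -scalerBr -mulmxBl costate_bound.
- by rewrite subr_ge0 lerBlDr lerDl andbC.
Qed.

End Costate.

(** * First-order variation of the terminal cost *)

Section Dot.
Variables (R : realType) (n : nat).
Implicit Types v w : 'rV[R]_n.

Definition dot v w : R := \sum_(i < n) v 0 i * w 0 i.

(** Unlike the sup norm, this sum is measurable termwise, and it is dual to the
    sup norm for the pairing dot. *)
Definition norm1 v : R := \sum_(i < n) `|v 0 i|.

Lemma dot_mulmx v w : dot v w = (v *m w^T) 0 0.
Proof. by rewrite mxE; apply: eq_bigr => i _; rewrite mxE. Qed.

Lemma dotBr u v w : dot u (v - w) = dot u v - dot u w.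
Proof. by rewrite !dot_mulmx linearB/= mulmxBr !mxE. Qed.

Lemma dotBl u v w : dot (u - v) w = dot u w - dot v w.
Proof. by rewrite !dot_mulmx mulmxBl !mxE. Qed.

Lemma dotNl u v : dot (- u) v = - dot u v.
Proof. by rewrite !dot_mulmx mulNmx mxE. Qed.

Lemma dotZr a u v : dot u (a *: v) = a * dot u v.
Proof. by rewrite !dot_mulmx linearZ/= -scalemxAr mxE. Qed.

Lemma dotZl a u v : dot (a *: u) v = a * dot u v.
Proof. by rewrite !dot_mulmx -scalemxAl mxE. Qed.

Lemma dot_adjoint u v (A : 'M[R]_n) : dot (u *m A^T) v = dot u (v *m A).
Proof. by rewrite !dot_mulmx trmx_mul mulmxA. Qed.

Lemma norm1_le v : norm1 v <= n%:R * `|v|.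
Proof.
apply: (@le_trans _ _ (\sum_(i < n) `|v|)).
  by apply: ler_sum => i _; exact: normr_coord_le.
by rewrite sumr_const card_ord -[leLHS]mulr_natl.
Qed.

Lemma norm1_ge0 v : 0 <= norm1 v. Proof. exact: sumr_ge0. Qed.

Lemma dot_norm1 v w : `|dot v w| <= `|v| * norm1 w.
Proof.
rewrite (le_trans (ler_norm_sum _ _ _))// mulr_sumr; apply: ler_sum => i _.
by rewrite normrM ler_wpM2r// normr_coord_le.
Qed.

Lemma dot_norm v w : `|dot v w| <= n%:R * (`|v| * `|w|).
Proof.
rewrite (le_trans (dot_norm1 v w))// mulrCA ler_wpM2l//; exact: norm1_le.
Qed.

Lemma is_derive_dot (p y : R -> 'rV[R]_n) (t : R) dp dy :
  is_derive t 1 p dp -> is_derive t 1 y dy ->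
  is_derive t 1 (fun s => dot (p s) (y s)) (dot dp (y t) + dot (p t) dy).
Proof.
move=> pt yt.
have di (i : 'I_n) : is_derive t 1 (fun s => p s 0 i * y s 0 i)
    (p t 0 i * dy 0 i + y t 0 i * dp 0 i).
  exact: is_deriveM (is_derive_coord i pt) (is_derive_coord i yt).
have := is_derive_sum di; rewrite fct_sumE => ds; apply: (is_derive_eq ds).
by rewrite /dot -big_split/=; apply: eq_bigr => i _; rewrite addrC (mulrC (y t 0 i)).
Qed.

Lemma abs_continuous_dot (a b : R) (p y : R -> 'rV[R]_n) : a <= b ->
  abs_continuous a b p -> abs_continuous a b y ->
  abs_continuous a b (fun s => dot (p s) (y s)).
Proof.
move=> ab pac yac.
have [P P0 pP] := abs_continuous_bounded ab pac.
have [Y Y0 yY] := abs_continuous_bounded ab yac.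
apply: (abs_continuous_dominated (M := n%:R * (P + Y)) pac yac) => u v uab vab.
have -> : dot (p v) (y v) - dot (p u) (y u) =
   dot (p v - p u) (y v) + dot (p u) (y v - y u).
  by rewrite dotBl dotBr addrA subrK.
rewrite (le_trans (ler_normD _ _))//.
rewrite (le_trans (lerD (dot_norm _ _) (dot_norm _ _)))//.
rewrite -mulrDr -mulrA ler_wpM2l//.
have := ler_wpM2l (normr_ge0 (p v - p u)) (yY _ vab).
have := ler_wpM2r (normr_ge0 (y v - y u)) (pP _ uab).
have := mulr_ge0 P0 (normr_ge0 (p v - p u)).
have := mulr_ge0 Y0 (normr_ge0 (y v - y u)).
lra.
Qed.

End Dot.

Lemma Rintegral_abs_continuous (R : realType) (f : R -> R) (M : R) :
  measurable_fun setT f -> (forall t, `|f t| <= M) ->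
  abs_continuous 0 1 (fun x => \int[@lebesgue_measure R]_(s in `[0, x]) f s).
Proof.
move=> mf fM; apply: (@lipschitz_abs_continuous _ _ _ _ _ M) => u v u0 uv v1.
exact: Rintegral_diff_bound.
Qed.

Lemma differentiable_expansion (R : realType) (V W : normedModType R)
    (f : V -> W) (x : V) (e : R) : differentiable f x -> 0 < e ->
  \forall v \near 0, `|f (x + v) - f x - 'D_v f x| <= e * `|v|.
Proof.
move=> df e0; have [_ fx] := (diff_locallyxP x f).1 df.
have /eqaddoP/(_ _ e0) : (fun h => f (h + x)) = (fun h => f x + 'd f x h) +o_0 id.
  by apply/funext => h; rewrite fx.
apply: filterS => v /=; rewrite deriveE// !fctE => h.
by rewrite (addrC x) -[f (v + x) - _ - _]addrA -opprD.
Qed.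

Lemma is_derive_scale (R : realType) (f : R -> R) (c t l : R) :
  is_derive t 1 f l -> is_derive t 1 (fun s => c * f s) (c * l).
Proof. by move=> df; exact: (is_deriveZ c df). Qed.

Lemma is_derive_sub (R : realType) (V : normedModType R) (f g : R -> V) (t : R) l m :
  is_derive t 1 f l -> is_derive t 1 g m ->
  is_derive t 1 (fun s => f s - g s) (l - m).
Proof. by move=> df dg; exact: (is_deriveB df dg). Qed.

Lemma is_derive_add (R : realType) (V : normedModType R) (f g : R -> V) (t : R) l m :
  is_derive t 1 f l -> is_derive t 1 g m ->
  is_derive t 1 (fun s => f s + g s) (l + m).
Proof. by move=> df dg; exact: (is_deriveD df dg). Qed.

Lemma dot_gradient (R : realType) n (C : 'rV[R]_n -> R) (x y : 'rV[R]_n) :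
  differentiable C x -> dot (gradient C x) y = 'D_y C x.
Proof.
move=> dC; rewrite deriveE// {2}(row_sum_delta y) linear_sum/=.
apply: eq_bigr => i _; rewrite linearZ/= mxE deriveE// mulrC.
by [].
Qed.

Lemma is_derive_cvg (R : realType) (f : R -> R) (t l : R) :
  h^-1 * (f (t + h) - f t) @[h --> 0^'] --> l -> is_derive t 1 f l.
Proof.
move=> fl; have {}fl : h^-1 *: ((f \o shift t) (h *: 1) - f t) @[h --> 0^'] --> l.
  move: fl; apply: cvg_trans; apply: near_eq_cvg; apply: nearW => h /=.
  by rewrite scaler1 (addrC t).
by split; [apply/cvg_ex; exists l|exact: cvg_lim fl].
Qed.

Section Sensitivity.
Variables (R : realType) (n : nat) (F : 'rV[R]_n -> R -> 'rV[R]_n).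
Variables (xbar : R -> 'rV[R]_n) (r L M Tbar kappa delta : R).
Variable X : R -> R -> 'rV[R]_n.
Notation mu := (@lebesgue_measure R).
Hypothesis HF : tube_regular F xbar r L M.
Hypothesis FD : forall t, differentiable (F^~ t) (xbar t).
Hypothesis xbarP : scaled_solution F Tbar xbar.

(** The bounds are required for every T, also where X T need not solve the
    equation, so that the estimates below hold along arbitrary sequences. *)
Record perturbed_family : Prop := PerturbedFamily {
  family_ac : forall T, abs_continuous 0 1 (X T) ;
  family_rate : forall T t, 0 <= t <= 1 ->
    `|X T t - xbar t| <= kappa * `|T - Tbar| ;
  family_tube : forall T t, 0 <= t <= 1 -> `|X T t - xbar t| <= r ;
  family_solution : forall T, `|T - Tbar| < delta ->
    X T 0 = xbar 0 /\ scaled_solution F T (X T) }.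

Hypothesis kappa0 : 0 <= kappa.
Hypothesis HX : perturbed_family.

Let J := state_jacobian F xbar.
Let L0 := tube_lip_ge0 HF.

Let Y T t := X T (clamp 0 1 t) - xbar (clamp 0 1 t).

Let Y_continuous T : continuous (Y T).
Proof.
have [xac _] := xbarP.
exact: (abs_continuous_clamp ler01 (abs_continuousB (family_ac HX T) xac)).
Qed.

Let Y_rate T t : `|Y T t| <= kappa * `|T - Tbar|.
Proof. by apply: (family_rate HX); exact: clamp_in ler01 t. Qed.

Let Y_tube T t : `|Y T t| <= r.
Proof. by apply: (family_tube HX); exact: clamp_in ler01 t. Qed.

(** F(x_T) - F(xbar) - y J, with the displacement y = x_T - xbar clamped to
    [0, 1] so that it is continuous on the whole line. *)
Definition linearization_error T t : 'rV[R]_n :=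
  F (xbar t + Y T t) t - F (xbar t) t - Y T t *m J t.

Let rho := linearization_error.

Let tube_zero : `|0 : 'rV[R]_n| <= r.
Proof. by rewrite normr0 ltW// (tube_radius HF). Qed.

Let F_tube_measurable (z : R -> 'rV[R]_n) i :
  continuous z -> (forall t, `|z t| <= r) ->
  measurable_fun setT (fun t : R => F (xbar t + z t) t 0 i).
Proof. by move=> zc zr; exact: (tube_measurable HF). Qed.

Let F_bar_measurable i : measurable_fun setT (fun t : R => F (xbar t) t 0 i).
Proof.
have c0 : continuous (cst 0 : R -> 'rV[R]_n) by move=> t; exact: cvg_cst.
have := F_tube_measurable i c0 (fun=> tube_zero).
by congr (measurable_fun _ _); apply/funext => t; rewrite addr0.
Qed.

Let rho_measurable T i : measurable_fun setT (fun t : R => rho T t 0 i).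
Proof.
rewrite (_ : (fun t => _) = (fun t => F (xbar t + Y T t) t 0 i -
  F (xbar t) t 0 i - \sum_(j < n) Y T t 0 j * J t j i)).
  apply: measurable_funB.
    by apply: measurable_funB => //; exact: F_tube_measurable.
  apply: measurable_sum => j; apply: measurable_funM.
    by apply: continuous_measurable_fun; exact: continuous_coord_row.
  exact: (jacobian_measurable HF FD).
by apply/funext => t; rewrite /rho /linearization_error !mxE.
Qed.

Let F_increment T t : `|F (xbar t + Y T t) t - F (xbar t) t| <= L * `|Y T t|.
Proof.
have := tube_lip HF t (Y_tube T t) tube_zero.
by rewrite addr0 subr0.
Qed.

Let rho_bound T t : `|rho T t| <= 2 * L * kappa * `|T - Tbar|.
Proof.
rewrite (le_trans (ler_normB _ _))//.
rewrite (le_trans (lerD (F_increment T t) (jacobian_bound HF FD _ _)))//.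
have := ler_wpM2l L0 (Y_rate T t); lra.
Qed.

Let rho_small t e : 0 < e ->
  \forall u \near 0, `|rho (Tbar + u) t| <= e * `|u|.
Proof.
move=> e0; have k1 : 0 < kappa + 1 by rewrite ltr_wpDl.
have e1 : 0 < e / (kappa + 1) by rewrite divr_gt0.
have /nbhs_ballP[d /= d0 dF] := differentiable_expansion (FD t) e1.
exists (d / (kappa + 1)); first by rewrite /= divr_gt0.
move=> u /=; rewrite sub0r normrN ltr_pdivlMr// => ud.
have Yu : `|Y (Tbar + u) t| <= kappa * `|u|.
  by rewrite (le_trans (Y_rate _ _))// addrAC subrr add0r.
have /= := dF (Y (Tbar + u) t); rewrite -ball_normE/= sub0r normrN.
rewrite (@deriveEjacobian _ _ _ _ _ (Y (Tbar + u) t) (FD t)) => h.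
have ukd : kappa * `|u| <= `|u| * (kappa + 1).
  by rewrite mulrDr mulr1 mulrC lerDl.
rewrite (le_trans (h _))//.
  exact: le_lt_trans Yu (le_lt_trans ukd ud).
rewrite mulrAC ler_pdivrMr// -mulrA ler_wpM2l ?(ltW e0)//.
exact: le_trans ukd.
Qed.

Let mean_error u : R := \int[mu]_(t in `[0, 1]) (norm1 (rho (Tbar + u) t) / `|u|).

Let norm1_rho_measurable T : measurable_fun setT (fun t : R => norm1 (rho T t)).
Proof.
by apply: measurable_sum => i; apply: measurableT_comp => //; exact: rho_measurable.
Qed.

Let norm1_rho_bound T t :
  norm1 (rho T t) <= n%:R * (2 * L * kappa * `|T - Tbar|).
Proof.
by rewrite (le_trans (norm1_le _))// ler_wpM2l.
Qed.

(** Dominated convergence along sequences: pointwise convergence comes from the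
    differentiability of F at xbar, the dominating constant from the Lipschitz
    bound. *)
Lemma mean_error_cvg0 : mean_error u @[u --> 0^'] --> 0.
Proof.
apply/cvgr_dnbhsP => u [u0 uc0].
pose c : R := n%:R * (2 * L * kappa).
have bnd k t : 0 <= norm1 (rho (Tbar + u k) t) / `|u k| <= c.
  rewrite divr_ge0 ?norm1_ge0//= ler_pdivrMr ?normr_gt0// /c -[leRHS]mulrA.
  by rewrite (le_trans (norm1_rho_bound _ _))// addrAC subrr add0r.
have ic : mu.-integrable `[0, 1] (EFin \o cst c).
  by apply: (@bounded_integrable_itv _ (cst c) `|c|) => //; exact: measurable_cst.
have := @dominated_cvg _ _ _ mu `[0, 1]%classic (measurable_itv _)
  (fun k t => (norm1 (rho (Tbar + u k) t) / `|u k|)%:E) (cst 0%E)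
  (EFin \o cst c).
rewrite integral0 => dct.
have {}dct : (\int[mu]_(t in `[0%R, 1%R])
     (norm1 (rho (Tbar + u k) t) / `|u k|)%:E @[k --> \oo] --> 0)%E.
  apply: dct => //.
  - move=> k; apply/measurable_EFinP/measurable_funTS; apply: measurable_funM => //.
    exact: norm1_rho_measurable.
  - move=> t _; apply: cvg_EFin; first exact: nearW.
    apply/cvgrPdist_le => e e0.
    have e1 : 0 < e / (n%:R + 1) by rewrite divr_gt0// ltr_wpDl.
    have [d /= d0 dr] := rho_small t e1.
    have /cvgrPdist_lt/(_ _ d0) := uc0; apply: filterS => k ukd /=.
    have [b0 _] := andP (bnd k t).
    rewrite sub0r normrN ger0_norm// ler_pdivrMr ?normr_gt0//.
    rewrite (le_trans (norm1_le _))//.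
    rewrite (le_trans (ler_wpM2l (ler0n _ _) (dr _ ukd)))//.
    rewrite mulrA ler_wpM2r// mulrCA ler_piMr ?(ltW e0)//.
    by rewrite ler_pdivrMr ?mul1r ?lerDl// ltr_wpDl.
  - move=> k t _ /=; rewrite lee_fin; have /andP[b0 b1] := bnd k t.
    by rewrite ger0_norm.
exact: fine_cvg dct.
Qed.

Variable p : R -> 'rV[R]_n.
Hypothesis pP : costate_ode F xbar Tbar p.

Let A : R := \int[mu]_(t in `[0, 1]) dot (p t) (F (xbar t) t).

(** Mean value inequality for the function of t equal to p . (x_T - xbar) minus
    (T - Tbar) times the integral of p . F(xbar) over [0, t]: its derivative
    only contains the two error terms, because the Jacobian cancels between
    the costate equation and the linearized state equation. *)
Lemma dual_increment : exists2 P, 0 <= P & forall T, 0 < `|T - Tbar| < delta ->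
  `|dot (p 1) (X T 1 - xbar 1) - (T - Tbar) * A| <=
  P * `|T - Tbar| * (`|T - Tbar| + mean_error (T - Tbar)).
Proof.
have [pac pode] := pP; have [xac xode] := xbarP.
have [P P0 pb] := abs_continuous_bounded ler01 pac.
pose P1 := P * (n%:R * (L * kappa) + `|Tbar|).
have P10 : 0 <= P1 by rewrite mulr_ge0// addr_ge0// !mulr_ge0.
exists P1 => // T /andP[Tgt0 Tdelta].
have [X0 [Xac Xode]] := family_solution HX Tdelta.
pose pF t := dot (p (clamp 0 1 t)) (F (xbar t) t).
have pFm : measurable_fun setT pF.
  apply: measurable_sum => i; apply: measurable_funM => //.
  apply: continuous_measurable_fun; apply: continuous_coord_row.
  exact: abs_continuous_clamp.
have pFb t : `|pF t| <= n%:R * (P * M).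
  rewrite (le_trans (dot_norm _ _))// ler_wpM2l// ler_pM//.
    by apply: pb; exact: clamp_in ler01 t.
  exact: (tube_bound HF).
pose e t := norm1 (rho T t).
have em : measurable_fun setT e by exact: norm1_rho_measurable.
have eb t : `|e t| <= n%:R * (2 * L * kappa * `|T - Tbar|).
  by rewrite ger0_norm ?norm1_ge0// norm1_rho_bound.
pose B t := \int[mu]_(s in `[0, t]) e s.
pose AA t := \int[mu]_(s in `[0, t]) pF s.
have AAE : AA 1 = A.
  by apply: eq_Rintegral => t; rewrite inE/= in_itv/= => t01; rewrite /pF clamp_id.
have BE : B 1 = `|T - Tbar| * mean_error (T - Tbar).
  have TT : Tbar + (T - Tbar) = T by rewrite addrC subrK.
  rewrite /mean_error TT RintegralZr//; last first.
    exact: (bounded_integrable_itv true false 0 1 em eb).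
  by rewrite mulrC divfK// gt_eqF.
have int0 (g : R -> R) : \int[mu]_(s in `[0, 0]) g s = 0.
  by rewrite set_itv1 Rintegral_set1.
pose h t := dot (p t) (X T t - xbar t) - (T - Tbar) * AA t.
pose w t := P * (n%:R * (L * kappa) * `|T - Tbar| ^+ 2 * t + `|Tbar| * B t).
have -> : dot (p 1) (X T 1 - xbar 1) - (T - Tbar) * A = h 1 - h 0.
  have dot0 : dot (p 0) 0 = 0 by rewrite /dot big1// => i _; rewrite mxE mulr0.
  by rewrite /h AAE X0 subrr dot0 /AA int0 mulr0 !subr0.
have w1 : w 1 - w 0 <= P1 * `|T - Tbar| * (`|T - Tbar| + mean_error (T - Tbar)).
  rewrite /w {2}/B int0 BE !mulr0 addr0 mulr0 subr0 mulr1 /P1.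
  have m0 : 0 <= mean_error (T - Tbar).
    by apply: Rintegral_ge0 => t _; rewrite divr_ge0// norm1_ge0.
  have c0 : 0 <= n%:R * (L * kappa) by rewrite !mulr_ge0.
  rewrite -!mulrA ler_wpM2l//.
  set a := `|T - Tbar| in Tgt0 *; set m := mean_error _ in m0 *.
  have := mulr_ge0 (mulr_ge0 c0 (ltW Tgt0)) m0.
  have := mulr_ge0 (normr_ge0 Tbar) (sqr_ge0 a).
  lra.
apply: le_trans w1; apply: abs_continuous_mean_value => //.
- have hac : abs_continuous 0 1 (fun t => dot (p t) (X T t - xbar t)).
    by apply: abs_continuous_dot => //; exact: abs_continuousB.
  apply: (abs_continuous_dominated (M := 1 + `|T - Tbar|) hac
    (Rintegral_abs_continuous pFm pFb)) => u v _ _.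
  rewrite /h opprD addrACA -opprD -mulrBr (le_trans (ler_normB _ _))// normrM.
  rewrite -/(AA v) -/(AA u) mulrDl mul1r mulrDr.
  have := mulr_ge0 (normr_ge0 (T - Tbar))
    (normr_ge0 (dot (p v) (X T v - xbar v) - dot (p u) (X T u - xbar u))).
  have := normr_ge0 (AA v - AA u).
  lra.
- have Bac := Rintegral_abs_continuous em eb.
  apply: (abs_continuous_dominated
    (M := P * (n%:R * (L * kappa) * `|T - Tbar| ^+ 2) + P * `|Tbar|)
    (@abs_continuous_id R 0 1) Bac) => u v _ _.
  rewrite /w -mulrBr opprD addrACA -!mulrBr -/(B u) -/(B v).
  have c0 : 0 <= n%:R * (L * kappa) * `|T - Tbar| ^+ 2.
    by rewrite !mulr_ge0.
  rewrite normrM (ger0_norm P0) -mulrDr -[leRHS]mulrA ler_wpM2l//.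
  set Q := n%:R * (L * kappa) * `|T - Tbar| ^+ 2 in c0 *.
  rewrite (le_trans (ler_normD _ _))// (normrM Q) (normrM `|Tbar|).
  rewrite (ger0_norm c0) normr_id.
  have := mulr_ge0 c0 (normr_ge0 (B v - B u)).
  have := mulr_ge0 (normr_ge0 Tbar) (normr_ge0 (v - u)).
  lra.
have dA := Rintegral_is_derive pFm pFb.
have dB := Rintegral_is_derive em eb.
apply: filterS3 (filterI dA dB) pode (filterI xode Xode).
move=> t [{}dA {}dB] {}pode [{}xode {}Xode] t01.
have [t0 t1] := andP t01.
have {}dA := dA t0; have {}dB := dB t0.
have tE : clamp 0 1 t = t by rewrite clamp_id// !ltW.
have YE : X T t - xbar t = Y T t by rewrite /Y tE.
have XE : X T t = xbar t + Y T t by rewrite -YE addrC subrK.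
exists (dot (- (Tbar *: (p t *m (J t)^T))) (X T t - xbar t) +
   dot (p t) (T *: F (X T t) t - Tbar *: F (xbar t) t) - (T - Tbar) * pF t).
exists (P * (n%:R * (L * kappa) * `|T - Tbar| ^+ 2 + `|Tbar| * e t)); split.
- have dy := is_derive_sub (Xode t01) (xode t01).
  exact: (is_derive_sub (is_derive_dot (pode t01) dy)
    (is_derive_scale (T - Tbar) dA)).
- have := is_derive_scale (n%:R * (L * kappa) * `|T - Tbar| ^+ 2)
    (is_derive_id (t : R) 1).
  rewrite mulr1 => d1.
  exact: (is_derive_scale P (is_derive_add d1 (is_derive_scale `|Tbar| dB))).
(* The Jacobian terms cancel by adjointness. *)
have -> : dot (- (Tbar *: (p t *m (J t)^T))) (X T t - xbar t) +
   dot (p t) (T *: F (X T t) t - Tbar *: F (xbar t) t) - (T - Tbar) * pF t =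
   (T - Tbar) * dot (p t) (F (xbar t + Y T t) t - F (xbar t) t) +
   Tbar * dot (p t) (rho T t).
  rewrite /rho /linearization_error /pF tE YE XE.
  rewrite dotNl dotZl dot_adjoint !dotBr !dotZr; ring.
have pt : `|p t| <= P by apply: pb; rewrite !ltW.
rewrite (le_trans (ler_normD _ _))// !normrM mulrDr; apply: lerD; last first.
  rewrite mulrCA ler_wpM2l// (le_trans (dot_norm1 _ _))//.
  by rewrite ler_wpM2r// norm1_ge0.
rewrite (mulrC (n%:R * _)) expr2 -mulrA [leRHS]mulrCA ler_wpM2l//.
rewrite (le_trans (dot_norm1 _ _))//.
apply: ler_pM => //; first exact: norm1_ge0.
rewrite (le_trans (norm1_le _))// mulrCA ler_wpM2l//.
by rewrite (le_trans (F_increment _ _))// mulrCA ler_wpM2l// mulrC.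
Qed.

(** To first order the variation of C is p(1) . (x_T(1) - xbar(1)), because
    p(1) is the gradient; dual_increment evaluates this product. *)
Theorem terminal_cost_derivative (C : 'rV[R]_n -> R) (CT : R -> R) :
  0 < delta -> differentiable C (xbar 1) -> p 1 = gradient C (xbar 1) ->
  (\forall T \near Tbar, forall x : R -> 'rV[R]_n,
     scaled_solution F T x -> x 0 = xbar 0 -> CT T = C (x 1)) ->
  is_derive Tbar 1 CT A.
Proof.
move=> delta0 dC p1 CTE; have [P P0 Pinc] := dual_increment.
have CTbar : CT Tbar = C (xbar 1) by apply: (nbhs_singleton CTE).
apply: is_derive_cvg; apply/cvgrPdist_le => e e0.
have k1 : 0 < 2 * (kappa + 1) by rewrite mulr_gt0// ltr_wpDl.
have P1 : 0 < 4 * (P + 1) by rewrite mulr_gt0// ltr_wpDl.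
have e1 : 0 < e / (2 * (kappa + 1)) by rewrite divr_gt0.
have e2 : 0 < e / (4 * (P + 1)) by rewrite divr_gt0.
have /nbhs_ballP[d /= d0 dCx] := differentiable_expansion dC e1.
have /cvgrPdist_le/(_ _ e2) me := mean_error_cvg0.
have CTu : \forall u \near 0^', forall x : R -> 'rV[R]_n,
    scaled_solution F (Tbar + u) x -> x 0 = xbar 0 -> CT (Tbar + u) = C (x 1).
  have /nbhs_ballP[d' /= d'0 h] := CTE.
  exists d' => // u /=; rewrite sub0r normrN => ud _; apply: h.
  by rewrite -ball_normE/= opprD addrA subrr sub0r normrN.
near=> u.
have u0 : u != 0 by near: u; exact: nbhs_dnbhs_neq.
have ugt0 : 0 < `|u| by rewrite normr_gt0.
have udelta : `|u| < delta by near: u; exact: dnbhs0_lt.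
have ud : `|u| < d / (kappa + 1).
  by near: u; apply: dnbhs0_lt; rewrite divr_gt0// ltr_wpDl.
have ue : `|u| <= e / (4 * (P + 1)) by near: u; exact: dnbhs0_le.
have uT : `|Tbar + u - Tbar| = `|u| by rewrite addrAC subrr add0r.
have [|X0 Xsol] := family_solution HX (T := Tbar + u); first by rewrite uT.
have -> : CT (Tbar + u) = C (X (Tbar + u) 1).
  by move: X0; move: Xsol; near: u; apply: filterS CTu => u; apply.
have mu_ : `|mean_error u| <= e / (4 * (P + 1)).
  rewrite -normrN -sub0r; near: u; exact: me.
rewrite CTbar; set y := X (Tbar + u) 1 - xbar 1.
have yu : `|y| <= kappa * `|u|.
  by rewrite -uT; apply: (family_rate HX); rewrite ler01 lexx.
have ydist : `|y| < d.
  rewrite (le_lt_trans yu)// mulrC; move: ud; rewrite ltr_pdivlMr ?ltr_wpDl//.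
  by apply: le_lt_trans; rewrite ler_wpM2l// lerDl.
have inc : `|dot (p 1) y - u * A| <= P * `|u| * (`|u| + mean_error u).
  have := Pinc (Tbar + u); rewrite uT ugt0 udelta => /(_ isT).
  by rewrite (_ : Tbar + u - Tbar = u)//; rewrite addrAC subrr add0r.
have exp : `|C (X (Tbar + u) 1) - C (xbar 1) - dot (p 1) y| <=
    e / (2 * (kappa + 1)) * (kappa * `|u|).
  rewrite p1 dot_gradient//.
  have := dCx y; rewrite -ball_normE/= sub0r normrN => /(_ ydist).
  rewrite {1}/y (addrC (xbar 1)) subrK => /le_trans; apply.
  by apply: ler_wpM2l => //; exact: ltW e1.
have -> : A - u^-1 * (C (X (Tbar + u) 1) - C (xbar 1)) =
  - (u^-1 * ((C (X (Tbar + u) 1) - C (xbar 1) - dot (p 1) y) +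
             (dot (p 1) y - u * A))).
  by field.
rewrite normrN normrM normfV ler_pdivrMl//.
rewrite (le_trans (ler_normD _ _))// (le_trans (lerD exp inc))//.
have c1 : e / (2 * (kappa + 1)) * kappa <= e / 2.
  rewrite invfM mulrA -mulrA ler_piMr ?divr_ge0 ?(ltW e0)//.
  by rewrite mulrC ler_pdivrMr ?mul1r ?lerDl// ltr_wpDl.
have c2 : P * (`|u| + mean_error u) <= e / 2.
  have : `|u| + mean_error u <= e / 2 / (P + 1).
    rewrite (le_trans (lerD ue (le_trans (ler_norm _) mu_)))//.
    have P1' : P + 1 != 0 by rewrite gt_eqF// ltr_wpDl.
    by rewrite le_eqVlt; apply/orP; left; apply/eqP; field.
  move=> h; rewrite (le_trans (ler_wpM2l P0 h))// mulrC mulrAC.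
  rewrite ler_pdivrMr ?ltr_wpDl// ler_wpM2l ?lerDl//.
  by rewrite divr_ge0// ltW.
have := ler_wpM2r (ltW ugt0) c1; have := ler_wpM2r (ltW ugt0) c2.
lra.
Unshelve. all: by end_near. Qed.

End Sensitivity.

(** Where perturbed_solution gives nothing, xbar itself satisfies the bounds. *)
Theorem perturbed_family_exists (R : realType) n (F : 'rV[R]_n -> R -> 'rV[R]_n)
    (xbar : R -> 'rV[R]_n) (r L M Tbar : R) :
  tube_regular F xbar r L M -> scaled_solution F Tbar xbar ->
  exists kappa delta X, [/\ 0 <= kappa, 0 < delta &
    perturbed_family F xbar r Tbar kappa delta X].
Proof.
move=> HF xbarP; have [kappa [delta [k0 d0 H]]] := perturbed_solution HF xbarP.
have r0 := ltW (tube_radius HF).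
have : forall T, exists x : R -> 'rV[R]_n, [/\ abs_continuous 0 1 x,
   forall t, 0 <= t <= 1 -> `|x t - xbar t| <= kappa * `|T - Tbar|,
   forall t, 0 <= t <= 1 -> `|x t - xbar t| <= r &
   `|T - Tbar| < delta -> x 0 = xbar 0 /\ scaled_solution F T x].
  move=> T; have [Td|Td] := ltP `|T - Tbar| delta.
    have [x [x0 xsol kr xb]] := H T Td; exists x; split => //.
      by case: xsol.
    by move=> t t01; exact: le_trans (xb t t01) (ltW kr).
  exists xbar; split => // [|t _|t _].
  - by case: xbarP.
  - by rewrite subrr normr0 mulr_ge0.
  - by rewrite subrr normr0.
move=> /choice[X XP]; exists kappa, delta, X; split => //.
by split => T; have [] := XP T.
Qed.

(** * Norms on row vectors and piecewise data *)

Section NormEquivalence.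
Variables (R : realType) (n : nat) (N : 'rV[R]_n -> R).
Hypothesis normN : is_norm N.

Lemma is_norm0 : N 0 = 0.
Proof. by have := is_norm_scale normN 0 0; rewrite scale0r normr0 mul0r. Qed.

Lemma is_normN x : N (- x) = N x.
Proof. by rewrite -scaleN1r (is_norm_scale normN) normrN normr1 mul1r. Qed.

Lemma is_norm_ge0 x : 0 <= N x.
Proof.
have := is_norm_triangle normN x (- x).
by rewrite subrr is_norm0 is_normN -mulr2n pmulrn_lge0.
Qed.

Lemma is_norm_upper : exists2 c, 0 <= c & forall x, N x <= c * `|x|.
Proof.
exists (\sum_(i < n) N (delta_mx 0 i)) => [|x].
  by apply: sumr_ge0 => i _; exact: is_norm_ge0.
rewrite {1}(row_sum_delta x) mulr_suml.
apply: (big_ind2 (fun v a => N v <= a)) => [|v a w b va wb|i _].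
- by rewrite is_norm0.
- by rewrite (le_trans (is_norm_triangle normN _ _))// lerD.
by rewrite (is_norm_scale normN) mulrC ler_wpM2l ?is_norm_ge0 ?normr_coord_le.
Qed.

(** N is continuous by the upper bound, so it has a positive minimum on the
    compact unit sphere, which is empty when n = 0. *)
Lemma is_norm_lower : exists2 c, 0 <= c & forall x, `|x| <= c * N x.
Proof.
have [C C0 NC] := is_norm_upper.
have Ncont : continuous N.
  move=> x; apply/(@cvgrPdist_le _ _ _ (nbhs x)) => e e0.
  have C1 : 0 < C + 1 by rewrite ltr_wpDl.
  apply/nbhs_ballP; exists (e / (C + 1)); first by rewrite /= divr_gt0.
  move=> y; rewrite -ball_normE/= ltr_pdivlMr// => xy.
  have Nd u v : N u - N v <= C * `|u - v|.
    rewrite lerBlDr (le_trans _ (lerD (NC _) (lexx _)))//.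
    by rewrite -{1}(subrK v u) is_norm_triangle.
  have h u v : `|u - v| * (C + 1) < e -> N u - N v <= e.
    move=> uv; rewrite (le_trans (Nd u v))// (le_trans _ (ltW uv))// mulrC.
    by rewrite ler_wpM2l// lerDl.
  rewrite ler_norml h// andbT lerNl opprB h// distrC//.
have [S0|/set0P/negP/negPn/eqP S0] := pselect ([set x : 'rV[R]_n | `|x| = 1] !=set0).
  have Scompact : compact [set x : 'rV[R]_n | `|x| = 1].
    apply: bounded_closed_compact.
      by exists 1; split => // b b1 x /= ->; exact: ltW.
    rewrite (_ : [set x | _] = (fun x : 'rV[R]_n => `|x|) @^-1` [set 1])//.
    apply: closed_comp => [x _|]; first exact: norm_continuous.
    exact: closed_eq.
  have [c cS cmin] := compact_EVT_min S0 Scompact (continuous_subspaceT Ncont).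
  have Nc : 0 < N c.
    rewrite lt_neqAle is_norm_ge0 andbT; apply/eqP => /esym/(is_norm_eq0 normN) c0.
    by move: cS; rewrite inE/= c0 normr0 => /esym/eqP; rewrite oner_eq0.
  exists (N c)^-1 => [|x]; first by rewrite invr_ge0 ltW.
  have [->|x0] := eqVneq x 0; first by rewrite normr0 is_norm0 mulr0.
  have x1 : 0 < `|x| by rewrite normr_gt0.
  rewrite ler_pdivlMl// mulrC.
  have := cmin (`|x|^-1 *: x); rewrite inE/= normrZ normfV normr_id mulVf ?gt_eqF//.
  move=> /(_ erefl); rewrite (is_norm_scale normN) normfV normr_id.
  by rewrite ler_pdivlMl.
exists 0 => // x; have [->|x0] := eqVneq x 0; first by rewrite normr0 mul0r.
have : [set x : 'rV[R]_n | `|x| = 1] (`|x|^-1 *: x).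
  by rewrite /= normrZ normfV normr_id mulVf// normr_eq0.
by rewrite S0.
Qed.

End NormEquivalence.

Section Piecewise.
Variables (R : realType) (k : nat) (s : nat -> R).
Hypothesis s_incr : forall j, (j <= k)%N -> s j < s j.+1.

Lemma knots_mono i j : (i <= j)%N -> (j <= k.+1)%N -> s i <= s j.
Proof.
elim: j => [|j IH]; first by rewrite leqn0 => /eqP ->.
rewrite leq_eqVlt => /predU1P[->//|]; rewrite ltnS => ij jk.
exact: le_trans (IH ij (ltnW jk)) (ltW (s_incr jk)).
Qed.

Lemma knots_unique i j t : (i <= k)%N -> (j <= k)%N ->
  s i < t < s i.+1 -> s j < t < s j.+1 -> i = j.
Proof.
move=> ik jk /andP[it ti] /andP[jt tj].
wlog ij : i j ik jk it ti jt tj / (i <= j)%N.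
  move=> h; have /orP[|] := leq_total i j; first exact: h.
  by move=> ji; apply/esym/h.
apply/eqP; rewrite eqn_leq ij/= leqNgt; apply/negP => ji.
have := knots_mono ji (leqW jk); rewrite leNgt => /negP; apply.
exact: lt_trans jt ti.
Qed.

Lemma piecewise_in (V : nmodType) (h : nat -> V) j t : (j <= k)%N ->
  s j < t < s j.+1 -> piecewise k s h t = h j.
Proof.
move=> jk tj; rewrite /piecewise (big_pred1 (Ordinal (jk : (j < k.+1)%N)))// => i.
apply/idP/eqP => [ti|->//]; apply: val_inj => /=.
by apply: knots_unique ti tj; [rewrite -ltnS|].
Qed.

(** Case analysis for piecewise, whose sum has at most one term. *)
Variant knot_spec (t : R) : Prop :=
| KnotIn j of (j <= k)%N & s j < t < s j.+1
| KnotOut of (forall (V : nmodType) (h : nat -> V), piecewise k s h t = 0).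

Lemma knotP t : knot_spec t.
Proof.
have [[j [jk tj]]|h] := pselect (exists j, (j <= k)%N /\ s j < t < s j.+1).
  exact: KnotIn jk tj.
apply: KnotOut => V g; rewrite /piecewise big_pred0// => i.
by apply/negbTE/negP => ti; apply: h; exists i; rewrite -ltnS.
Qed.

End Piecewise.

(** * The control problem *)

Lemma continuous_within_comp (T U V : topologicalType) (A : set U) (g : U -> V)
    (c : T -> U) : {within A, continuous g} -> continuous c ->
  (forall t, A (c t)) -> continuous (fun t => g (c t)).
Proof.
move=> /subspace_continuousP gA cc cA t.
apply: cvg_comp (gA (c t) (cA t)) => P AP.
have h : nbhs t (c @^-1` [set u | A u -> P u]) := cc t _ AP.
suff : nbhs t (c @^-1` P) by [].
by apply: filterS h => u; apply; exact: cA.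
Qed.

Section Concrete.
Variables (R : realType) (n m k : nat).
Variables (f : 'rV[R]_n * 'rV[R]_m -> 'rV[R]_n).
Variables (phi : nat -> 'rV[R]_n -> R -> 'rV[R]_m) (s : nat -> R).
Variables (N : 'rV[R]_n -> R) (xbar : R -> 'rV[R]_n) (rho : R).
Hypothesis normN : is_norm N.
Hypothesis s0 : s 0%N = 0.
Hypothesis s1 : s k.+1 = 1.
Hypothesis s_incr : forall j, (j <= k)%N -> s j < s j.+1.
Hypothesis xbar_ac : abs_continuous 0 1 xbar.
Hypothesis rho0 : 0 < rho.
Hypothesis f_continuous : forall j, (j <= k)%N ->
  {within tube s N xbar rho j, continuous (fun z => fj f phi j z.1 z.2)}.
Hypothesis f_lipschitz : forall j, (j <= k)%N ->
  exists L : R, forall (x y : 'rV[R]_n) (tau : R),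
    tube s N xbar rho j (x, tau) -> tube s N xbar rho j (y, tau) ->
    N (fj f phi j x tau - fj f phi j y tau) <= L * N (x - y).

Let FF := F k f phi s.

(** The field along xbar + z on the j-th interval, frozen beyond its endpoints:
    when N(z) <= rho, a continuous function of t on the whole line, because its
    argument never leaves the tube. *)
Let stage (j : nat) (z : R -> 'rV[R]_n) (t : R) : 'rV[R]_n :=
  let u := clamp (s j) (s j.+1) t in fj f phi j (xbar u + z u) u.

Let stage_continuous j z : (j <= k)%N -> continuous z ->
  (forall t, N (z t) <= rho) -> continuous (stage j z).
Proof.
move=> jk zc zr; have sj := ltW (s_incr jk).
have clamp_cont : continuous (clamp (s j) (s j.+1)).
  move=> t; apply/cvgrPdist_lt => e e0; exists e => //= u; apply: le_lt_trans.
  exact: clamp_dist.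
pose g := clamp (s j) (s j.+1); pose a t := xbar (g t) + z (g t).
have xc : continuous (xbar \o g).
  apply: abs_continuous_clamp => //; apply: abs_continuous_sub xbar_ac.
    by rewrite -s0; apply: (knots_mono s_incr) => //; exact: leqW.
  by rewrite -s1; apply: (knots_mono s_incr).
have ac : continuous a.
  move=> t; apply: cvgD; first exact: xc.
  exact: (continuous_comp (clamp_cont t) (zc _)).
apply: (continuous_within_comp (c := fun t => (a t, g t)) (f_continuous jk)).
  by move=> t; exact: (cvg_pair (ac t) (clamp_cont t)).
move=> t; split; first exact: clamp_in.
by rewrite /a /= addrAC subrr add0r.
Qed.

Let F_stage j (z : R -> 'rV[R]_n) t : (j <= k)%N -> s j < t < s j.+1 ->
  FF (xbar t + z t) t = stage j z t.
Proof.
move=> jk tj; rewrite /FF /F (piecewise_in s_incr _ jk tj) /stage/= clamp_id//.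
by case/andP: tj => *; rewrite !ltW.
Qed.

Let F_measurable (z : R -> 'rV[R]_n) : continuous z -> (forall t, N (z t) <= rho) ->
  forall i, measurable_fun setT (fun t : R => FF (xbar t + z t) t 0 i).
Proof.
move=> zc zr i.
rewrite (_ : (fun t => _) = (fun t => \sum_(j < k.+1)
   \1_(`]s j, s j.+1[%classic : set R) t * stage j z t 0 i)).
  apply: measurable_sum => j; apply: measurable_funM; first exact: measurable_indic.
  apply: continuous_measurable_fun; apply: continuous_coord_row.
  by apply: stage_continuous => //; rewrite -ltnS.
apply/funext => t.
rewrite /FF /F /piecewise summxE big_mkcond/=; apply: eq_bigr => j _.
rewrite indicE mem_setE/= in_itv/=; case: ifPn => tj; last by rewrite mul0r.
rewrite mul1r /stage/= clamp_id//.
by case/andP: tj => *; rewrite !ltW.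
Qed.

(** Translation of the hypotheses from N to the sup norm, and from one
    constant per interval to uniform constants, obtained by summation.  The
    bound of F along xbar comes from continuity on compact intervals. *)
Theorem control_tube_regular : exists r L M, tube_regular FF xbar r L M.
Proof.
have [c c0 Nc] := is_norm_upper normN.
have [d d0 cN] := is_norm_lower normN.
have c1 : 0 < c + 1 by rewrite ltr_wpDl.
pose r := rho / (c + 1).
have r_gt0 : 0 < r by rewrite divr_gt0.
have Nr x : `|x| <= r -> N x <= rho.
  move=> xr; rewrite (le_trans (Nc x))//.
  rewrite (le_trans (ler_wpM2l c0 xr))// /r mulrCA ler_piMr ?(ltW rho0)//.
  by rewrite ler_pdivrMr// mul1r lerDl.
have N0 : N 0 <= rho by rewrite (is_norm0 normN) ltW.
have : forall j, exists LM : R * R, (j <= k)%N ->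
    [/\ 0 <= LM.1, 0 <= LM.2,
     forall t x y, s j < t < s j.+1 -> `|x| <= r -> `|y| <= r ->
       `|FF (xbar t + x) t - FF (xbar t + y) t| <= LM.1 * `|x - y| &
     forall t, s j < t < s j.+1 -> `|FF (xbar t) t| <= LM.2].
  move=> j; have [jk|jk] := boolP (j <= k)%N; last by exists (0, 0).
  have [L Lj] := f_lipschitz jk.
  have c0c : continuous (cst 0 : R -> 'rV[R]_n) by move=> t; exact: cvg_cst.
  have st := stage_continuous jk c0c (fun=> N0).
  have [M M0 stM] : exists2 B, 0 <= B &
      forall t, s j <= t <= s j.+1 -> `|stage j (cst 0) t| <= B.
    apply: continuous_clamp_bounded => t; apply: continuous_comp; last exact: st.
    apply/cvgrPdist_lt => e e0; exists e => //= u; apply: le_lt_trans.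
    exact: clamp_dist.
  exists (d * (`|L| * c), M) => _; split => //=.
  - by rewrite !mulr_ge0.
  - move=> t x y tj xr yr.
    have tj' : s j <= t <= s j.+1 by case/andP: tj => *; rewrite !ltW.
    rewrite (F_stage (cst x) jk tj) (F_stage (cst y) jk tj) /stage/= clamp_id//.
    rewrite (le_trans (cN _))// -mulrA ler_wpM2l//.
    have tx v : `|v| <= r -> tube s N xbar rho j (xbar t + v, t).
      by move=> vr; split => //=; rewrite addrAC subrr add0r Nr.
    rewrite (le_trans (Lj _ _ _ (tx _ xr) (tx _ yr)))//.
    rewrite opprD addrACA subrr add0r -mulrA.
    rewrite (le_trans (ler_wpM2r (is_norm_ge0 normN _) (ler_norm L)))//.
    by rewrite ler_wpM2l.
  - move=> t tj; rewrite -[xbar t]addr0 (F_stage (cst 0) jk tj) stM//.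
    by case/andP: tj => *; rewrite !ltW.
move=> /choice[LM LMP].
exists r, (\sum_(j < k.+1) (LM j).1), (\sum_(j < k.+1) (LM j).2).
have le_sum (g : nat -> R) j : (forall i, (i <= k)%N -> 0 <= g i) -> (j <= k)%N ->
    g j <= \sum_(i < k.+1) g i.
  move=> g0 jk; rewrite (bigD1 (Ordinal (jk : (j < k.+1)%N)))//= lerDl.
  by apply: sumr_ge0 => i _; apply: g0; rewrite -ltnS.
have L0 i : (i <= k)%N -> 0 <= (LM i).1 by move=> /LMP[].
have M0 i : (i <= k)%N -> 0 <= (LM i).2 by move=> /LMP[].
split => //.
- by apply: sumr_ge0 => i _; apply: L0; rewrite -ltnS.
- move=> x t t01; case: (knotP k s t) => [j jk tj|]; last exact.
  case/negP: t01; case/andP: tj => jt tj.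
  rewrite -s0 -s1 (le_lt_trans _ jt) ?(lt_le_trans tj)//.
    exact: (knots_mono s_incr).
  by apply: (knots_mono s_incr) => //; exact: leqW.
- move=> t x y xr yr; case: (knotP k s t) => [j jk tj|h]; last first.
    rewrite /FF /F !h subrr normr0 mulr_ge0//.
    by apply: sumr_ge0 => i _; apply: L0; rewrite -ltnS.
  have [_ _ Lj _] := LMP j jk; rewrite (le_trans (Lj t x y tj xr yr))//.
  by rewrite ler_wpM2r//; exact: (le_sum (fun i => (LM i).1)).
- move=> t; case: (knotP k s t) => [j jk tj|h]; last first.
    rewrite /FF /F !h normr0.
    by apply: sumr_ge0 => i _; apply: M0; rewrite -ltnS.
  have [_ _ _ Mj] := LMP j jk; rewrite (le_trans (Mj t tj))//.
  exact: (le_sum (fun i => (LM i).2)).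
- by move=> z zc zr; apply: F_measurable => // t; exact: Nr.
Qed.

Lemma control_differentiable :
  (forall j, (j <= k)%N -> forall tau, s j < tau < s j.+1 ->
    differentiable (fun x => fj f phi j x tau) (xbar tau)) ->
  forall t, differentiable (FF^~ t) (xbar t).
Proof.
move=> fd t; case: (knotP k s t) => [j jk tj|h].
  rewrite (_ : FF^~ t = fun x => fj f phi j x t); first exact: fd.
  by apply/funext => x; rewrite /FF /F (piecewise_in s_incr _ jk tj).
rewrite (_ : FF^~ t = cst 0); first exact: differentiable_cst.
by apply/funext => x; rewrite /FF /F h.
Qed.

Lemma hamiltonianE x p t : H k f phi s x p t = dot p (FF x t).
Proof.
rewrite /H /FF /F; case: (knotP k s t) => [j jk tj|h].
  by rewrite !(piecewise_in s_incr _ jk tj) dot_mulmx.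
by rewrite !h /dot big1// => i _; rewrite mxE mulr0.
Qed.

Lemma state_solutionE x0 T x :
  state_solution k f phi s x0 T x <-> scaled_solution FF T x /\ x 0 = x0.
Proof.
by split=> -[[xac xode] x00]; split.
Qed.

Lemma costate_solutionE C Tbar p : costate_solution k f phi s C Tbar xbar p <->
  costate_ode FF xbar Tbar p /\ p 1 = gradient C (xbar 1).
Proof.
by split=> -[[pac pode] p1]; split.
Qed.

End Concrete.

Theorem theorem4p1 (R : realType) (n m k : nat)
    (C : 'rV[R]_n -> R) (f : 'rV[R]_n * 'rV[R]_m -> 'rV[R]_n)
    (phi : nat -> 'rV[R]_n -> R -> 'rV[R]_m) (s : nat -> R)
    (N : 'rV[R]_n -> R) (x0 : 'rV[R]_n) (Tbar : R)
    (xbar : R -> 'rV[R]_n) (rho : R) :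
  (forall x, differentiable C x) ->
  (forall z, differentiable f z) ->
  is_norm N ->
  s 0%N = 0 -> s k.+1 = 1 ->
  (forall j, (j <= k)%N -> s j < s j.+1) ->
  state_solution k f phi s x0 Tbar xbar ->
  0 < rho ->
  (forall j, (j <= k)%N ->
    {within tube s N xbar rho j, continuous (fun z => fj f phi j z.1 z.2)}) ->
  (forall j, (j <= k)%N -> exists L : R, forall (x y : 'rV[R]_n) (tau : R),
    tube s N xbar rho j (x, tau) -> tube s N xbar rho j (y, tau) ->
    N (fj f phi j x tau - fj f phi j y tau) <= L * N (x - y)) ->
  (forall j, (j <= k)%N -> forall tau, s j < tau < s j.+1 ->
    differentiable (fun x => fj f phi j x tau) (xbar tau)) ->
  [/\ \forall T \near Tbar, unique_on01 (state_solution k f phi s x0 T),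
      unique_on01 (costate_solution k f phi s C Tbar xbar) &
      forall (CT : R -> R) (p : R -> 'rV[R]_n),
        (\forall T \near Tbar, forall x : R -> 'rV[R]_n,
           state_solution k f phi s x0 T x -> CT T = C (x 1)) ->
        costate_solution k f phi s C Tbar xbar p ->
        is_derive Tbar 1 CT
          (\int[@lebesgue_measure R]_(tau in `[0, 1])
             H k f phi s (xbar tau) (p tau) tau)].
Proof.
move=> dC _ normN s0 s1 s_incr /state_solutionE[xbarP xbar0] rho0 fc flip fd.
have [xbar_ac _] := xbarP.
have [r [L [M HF]]] :=
  control_tube_regular normN s0 s1 s_incr xbar_ac rho0 fc flip.
have FD := control_differentiable s_incr fd.
split.
- have [kappa [delta [_ delta0 near_sol]]] := perturbed_solution HF xbarP.
  exists delta => // T /=; rewrite distrC => /near_sol.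
  move=> [x [x00 xsol kr xrate]]; exists x.
  split; first by apply/state_solutionE; rewrite x00.
  move=> y /state_solutionE[ysol y0] t; rewrite in_itv/= => t01.
  by apply: (tube_uniqueness HF xbarP xsol ysol) kr xrate _ t01; rewrite x00 y0.
- have [p [pode p1]] := costate_exists Tbar HF FD (gradient C (xbar 1)).
  exists p; split; first exact/costate_solutionE.
  move=> q /costate_solutionE[qode q1] t; rewrite in_itv/= => t01.
  by apply: (costate_unique HF FD pode qode) t01; rewrite p1 q1.
move=> CT p CTE /costate_solutionE[pode p1].
have [kappa [delta [X [k0 delta0 HX]]]] := perturbed_family_exists HF xbarP.
under eq_Rintegral => t _ do rewrite (hamiltonianE f phi s_incr).
have := terminal_cost_derivative HF FD xbarP k0 HX pode delta0 (dC _) p1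
  (CT := CT).
apply; apply: filterS CTE => T CTE x xsol x00; apply: CTE.
by apply/state_solutionE; rewrite x00.
Qed.
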